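(* Let $(p_n)_{n\ge 1}$ be a sequence in $[0,1]$ with $p_n = \frac1n + O(n^{-4/3})$ as $n\to\infty$, and write $p=p_n$. Let $\mathcal L(\vec G(n,p))$ denote the length of the longest saop in $\vec G(n,p)$. Then there exist $c,C>0$ such that for every integer $n\ge 1$ and every $x>C$, \[ \mathbb P\big(\operatorname{diam}(\vec G(n,p))>x n^{1/3}\big)\le \mathbb P\big(\mathcal L(\vec G(n,p))>x n^{1/3}\big)\le e^{-cx\log x}. \]
   Context: For $n\ge 1$ and $p\in[0,1]$, $\vec G(n,p)$ is the random directed graph on the vertex set $\{1,2,\dots,n\}$ in which each of the $n(n-1)$ possible directed edges $(u,v)$, $u\ne v$, is independently present with probability $p$. A saop (self-avoiding oriented path) of length $k$ in a directed graph $\vec G$ is a sequence of vertices $(v_0,v_1,\dots,v_k)$ such that the oriented edges $(v_0,v_1),\dots,(v_{k-1},v_k)$ are pairwise different and all belong to $\vec G$ (a single vertex is a saop of length $0$). For vertices $i,j$ of $\vec G$, $d_\rightarrow(i,j)$ is the minimal length of a saop from $i$ to $j$, with $d_\rightarrow(i,j)=-\infty$ if there is no such path. The diameter is $\operatorname{diam}(\vec G):=\max_{i,j\in\vec G} d_\rightarrow(i,j)$. *)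

(* Defs.v *)
From HB Require Import structures.
From mathcomp Require Import all_boot all_order all_algebra.
From mathcomp Require Import all_classical all_reals all_analysis.
Set Implicit Arguments.
Unset Strict Implicit.
Unset Printing Implicit Defensive.
Import Order.TTheory GRing.Theory Num.Theory.
Import numFieldNormedType.Exports.
Local Open Scope ring_scope.

(* A directed graph on V is given by its set of edges G : {set V * V}. *)

(* The sequence (v_0, ..., v_k) is v :: s with k = size s. The list
   zip (v :: s) s is [:: (v_0, v_1); ...; (v_(k-1), v_k)]. Only the edges are
   required to be pairwise different: a vertex may be repeated. *)
Definition saop (V : finType) (G : {set V * V}) (v : V) (s : seq V) : bool :=
  all (mem G) (zip (v :: s) s) && uniq (zip (v :: s) s).

Lemma saop_size (V : finType) (G : {set V * V}) (v : V) (s : seq V) :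
  saop G v s -> (size s <= #|G|)%N.
Proof.
case/andP => /allP sG us.
have <- : size (zip (v :: s) s) = size s by rewrite size_zip; apply/minn_idPr => /=.
by rewrite -(card_uniqP us); apply/subset_leq_card/fintype.subsetP => e /sG.
Qed.

Definition has_saop (V : finType) (G : {set V * V}) (i j : V) (k : nat) : bool :=
  [exists s : k.-tuple V, saop G i s && (last i s == j)].

Definition ddist (R : realType) (V : finType) (G : {set V * V}) (i j : V) :
    \bar R :=
  if pselect (exists k, has_saop G i j k) is left ex_k
  then (ex_minn ex_k)%:R%:E else -oo%E.

Definition diam (R : realType) (V : finType) (G : {set V * V}) : \bar R :=
  \big[Order.max/-oo%E]_(i : V) \big[Order.max/-oo%E]_(j : V) ddist R G i j.

(* By saop_size, the bound k <= #|G| excludes no saop. *)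
Definition longest_saop (V : finType) (G : {set V * V}) : nat :=
  \max_(k < #|G|.+1 | [exists i, exists j, has_saop G i j k]) k.

(* The vertex set {1, ..., n} is represented by 'I_n. *)
Definition possible_edges (n : nat) : {set 'I_n * 'I_n} :=
  [set e | e.1 != e.2].

(* The law of the random directed graph with independent edges: a graph G
   without loops has probability the product over all possible edges e of
   p if e is in G and 1 - p otherwise. *)
Definition Gnp_pr (R : realType) (n : nat) (p : R)
    (E : pred {set 'I_n * 'I_n}) : R :=
  \sum_(G in powerset (possible_edges n) | E G)
    \prod_(e in possible_edges n) (if e \in G then p else 1 - p).

(* Main.v *)
Require Import Defs.
From HB Require Import structures.
From mathcomp Require Import all_boot all_order all_algebra.
From mathcomp Require Import all_classical all_reals all_analysis.
From mathcomp Require Import ring lra zify.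
Import Order.TTheory GRing.Theory Num.Theory.
Import numFieldNormedType.Exports.
Import boot.fintype boot.finset.
Local Open Scope ring_scope.
Set Implicit Arguments.
Unset Strict Implicit.
Unset Printing Implicit Defensive.

(** Let t = n^(1/3), let h be about t and let w^2 t be the length of the trail.

    Harris' inequality bounds the probability of a trail of length k from a
    given vertex by the recursion of a binomial branching process, hence it is
    O(1/h) for k = h; by the BK inequality, two edge-disjoint trails of length h,
    one entering and one leaving given places, have probability O(1/h^2).

    Let s be about w t^2 / 6 and let v be the vertex which the long trail reaches
    after 2h steps. If s vertices can be reached from v, then there are h edges
    of the trail, each of them between two trails of length h, from which s
    vertices can be reached. Conditionally on a few witnessing trails, the latter
    has probability exp(- c w^3): the exploration process has drift - i / n at
    step i. If fewer than s vertices can be reached from v, then there are h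
    trails of length about w^2 t, again between two trails of length h, from
    which fewer than s vertices can be reached. Since a trail mostly consists of
    different vertices, the exploration starts with about w^2 t vertices and
    dies before s steps, which again has probability exp(- c w^3). In both cases
    the expected number of such edges or trails is O(n / h^2) exp(- c w^3), and
    Markov's inequality gives the bound O(n / h^3) exp(- c w^3).

    For x >> t^2 it is enough to count the edges. *)

(** * Product Bernoulli measures on sets of edges *)

Lemma setU1_ind (T : finType) (P : {set T} -> Prop) :
  P set0 -> (forall (e : T) (E : {set T}), e \notin E -> P E -> P (e |: E)) -> forall E, P E.
Proof.
move=> P0 PU E; have [m] := ubnP #|E|; elim: m E => // m IH E.
have [->//|[e eE]] := set_0Vmem E.
rewrite (cardsD1 e) eE ltnS => lt_m; rewrite -(setD1K eE).
by apply: PU; [rewrite setD11 | exact: IH].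
Qed.

Section BernoulliExpectation.
Variables (R : realType) (T : finType) (p : R).
Implicit Types (e : T) (E F G H : {set T}) (f g : {set T} -> R) (A B W : pred {set T}).

(** The edge set [E] is a parameter, so that conditioning on revealed edges amounts to passing to a
    smaller [E]. *)
Definition bexp E f : R :=
  \sum_(G in powerset E) (\prod_(e in E) (if e \in G then p else 1 - p)) * f G.

Lemma eq_bexp E f g : {in powerset E, f =1 g} -> bexp E f = bexp E g.
Proof. by move=> fg; apply: eq_bigr => G GE; rewrite fg. Qed.

Lemma bexp_set0 f : bexp set0 f = f set0.
Proof. by rewrite /bexp powerset0 big_set1 big_set0 mul1r. Qed.

Lemma bexp_setU1 e E f : e \notin E ->
  bexp (e |: E) f = p * bexp E (fun G => f (e |: G)) + (1 - p) * bexp E f.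
Proof.
move=> eE; rewrite /bexp (bigID (fun G : {set T} => e \in G)) /=; congr (_ + _).
  rewrite (reindex_onto (fun G => e |: G) (fun G => G :\ e)) /=; last first.
    by move=> G /andP[_ eG]; rewrite setD1K.
  rewrite mulr_sumr; apply: eq_big => G.
    rewrite !powersetE setU11 andbT; apply/andP/idP => [[GE /eqP <-]|GE].
      by rewrite subDset.
    have eG : e \notin G by apply: contra eE; apply: subsetP.
    by rewrite setUS // setU1K.
  rewrite powersetE => /andP[/andP[GE _] /eqP eqG].
  have eG : e \notin G by rewrite -eqG setD11.
  rewrite big_setU1 //= setU11 mulrA; congr (_ * _ * _).
  apply: eq_bigr => i iE; rewrite in_setU1.
  by case: eqP => // ie; rewrite -ie iE in eE.
rewrite mulr_sumr; apply: eq_big => G.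
  rewrite !powersetE; apply/andP/idP => [[GE eG]|GE].
    apply/subsetP => i iG; move/subsetP: GE => /(_ i iG).
    by rewrite in_setU1 => /orP[/eqP ie|//]; rewrite -ie iG in eG.
  split; first exact: subset_trans GE (subsetUr _ _).
  by apply: contra eE; apply: subsetP.
by move=> /andP[_ eG]; rewrite big_setU1 //= (negPf eG) mulrA.
Qed.

Lemma bexpD E f g : bexp E (fun G => f G + g G) = bexp E f + bexp E g.
Proof. by rewrite -big_split; apply: eq_bigr => G _; rewrite mulrDr. Qed.

Lemma bexpZ E a f : bexp E (fun G => a * f G) = a * bexp E f.
Proof. by rewrite mulr_sumr; apply: eq_bigr => G _; rewrite mulrCA. Qed.

Lemma bexpN E f : bexp E (fun G => - f G) = - bexp E f.
Proof. by rewrite -sumrN; apply: eq_bigr => G _; rewrite mulrN. Qed.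

Lemma bexp_cst E a : bexp E (fun=> a) = a.
Proof.
elim/setU1_ind: E => [|e E eE IH]; first by rewrite bexp_set0.
by rewrite bexp_setU1 // IH; ring.
Qed.

Lemma bexp_sum (I : finType) (P : pred I) E (f : I -> {set T} -> R) :
  bexp E (fun G => \sum_(i | P i) f i G) = \sum_(i | P i) bexp E (f i).
Proof.
rewrite exchange_big; apply: eq_bigr => G _.
by rewrite mulr_sumr.
Qed.

Lemma bexpU E F f : [disjoint E & F] ->
  bexp (E :|: F) f = bexp E (fun G => bexp F (fun H => f (G :|: H))).
Proof.
elim/setU1_ind: E f => [|e E eE IH] f.
  by rewrite set0U bexp_set0 => _; apply: eq_bexp => G _; rewrite set0U.
rewrite -setI_eq0 setIUl setU_eq0 !setI_eq0 disjoints1 => /andP[eF dEF]; rewrite -setUA.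
rewrite bexp_setU1 ?inE ?negb_or ?eE // (bexp_setU1 _ eE) !IH //.
congr (_ * _ + _); apply: eq_bexp => G _; apply: eq_bexp => H _.
by rewrite setUA.
Qed.

Hypothesis p01 : 0 <= p <= 1.

Lemma le_bexp E f g : {in powerset E, forall G, f G <= g G} ->
  bexp E f <= bexp E g.
Proof.
case/andP: p01 => p0 p1 fg; apply: ler_sum => G GE; apply: ler_wpM2l (fg G GE).
by apply: prodr_ge0 => e _; case: ifP => // _; rewrite subr_ge0.
Qed.

Lemma bexp_ge0 E f : (forall G, 0 <= f G) -> 0 <= bexp E f.
Proof. by move=> f0; rewrite -(bexp_cst E 0); apply: le_bexp. Qed.

(** * Correlation inequalities and conditioning on witnesses *)

Definition increasing f := forall G H, G \subset H -> f G <= f H.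

Lemma increasing_setU1 e f : increasing f -> increasing (fun G => f (e |: G)).
Proof. by move=> fi G H GH; apply/fi/setUS. Qed.

Lemma bexp_le_setU1 e E f : increasing f -> bexp E f <= bexp E (fun G => f (e |: G)).
Proof. by move=> fi; apply: le_bexp => G _; apply/fi/subsetUr. Qed.

Lemma harris E f g : increasing f -> increasing g ->
  bexp E f * bexp E g <= bexp E (fun G => f G * g G).
Proof.
case/andP: (p01) => p0 p1.
elim/setU1_ind: E f g => [|e E eE IH] f g fi gi; first by rewrite !bexp_set0.
rewrite !bexp_setU1 //.
have IH0 := IH f g fi gi.
have IH1 := IH _ _ (increasing_setU1 e fi) (increasing_setU1 e gi).
have f01 := bexp_le_setU1 e E fi.
have g01 := bexp_le_setU1 e E gi.
set f1 := fun G => f (e |: G) in IH1 f01 *; set g1 := fun G => g (e |: G) in IH1 g01 *.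
set a0 := bexp E f in IH0 f01 *; set b0 := bexp E g in IH0 g01 *.
set a1 := bexp E f1 in IH1 f01 *; set b1 := bexp E g1 in IH1 g01 *.
have := ler_wpM2l p0 IH1; have := ler_wpM2l (_ : 0 <= 1 - p) IH0.
rewrite subr_ge0 => /(_ p1) h0 h1.
(* Once the induction hypothesis is used for both states of [e], what remains is the covariance of
   the two conditional means. *)
have : 0 <= (p * (1 - p)) * ((a1 - a0) * (b1 - b0)).
  by rewrite !mulr_ge0 ?subr_ge0.
lra.
Qed.

Lemma harris_dec E f g : increasing f -> increasing (fun G => - g G) ->
  bexp E (fun G => f G * g G) <= bexp E f * bexp E g.
Proof.
move=> fi gi; have := harris E fi gi.
have -> : bexp E (fun G => f G * - g G) = - bexp E (fun G => f G * g G).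
  by rewrite -bexpN; apply: eq_bexp => G _; rewrite mulrN.
by rewrite bexpN mulrN lerN2.
Qed.

Definition incrb (A : pred {set T}) := forall G H, G \subset H -> A G -> A H.

Lemma incrbP A : incrb A -> increasing (fun G => (A G)%:R).
Proof.
by move=> Ai G H GH; have := Ai G H GH; case: (A G) => [->//|_]; case: (A H).
Qed.

Lemma incrb_setU1 e (A : pred {set T}) :
  incrb A -> incrb (fun G => A (e |: G)).
Proof. by move=> Ai G H GH; apply/Ai/setUS. Qed.

Definition bprob E (A : pred {set T}) : R := bexp E (fun G => (A G)%:R).

Lemma le_bprob E (A B : pred {set T}) :
  (forall G, G \subset E -> A G -> B G) -> bprob E A <= bprob E B.
Proof.
move=> AB; apply: le_bexp => G; rewrite powersetE => /AB.
by case: (A G) => [->//|_]; case: (B G).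
Qed.

Lemma bprob_ge0 E A : 0 <= bprob E A.
Proof. exact: bexp_ge0. Qed.

Lemma bprob_le1 E A : bprob E A <= 1.
Proof. by rewrite -(bexp_cst E 1); apply: le_bexp => G _; case: (A G). Qed.

(** Disjoint occurrence in the sense of van den Berg and Kesten. For increasing events, all edges
    outside the witness [H] of [A] may be left to [B]. *)
Definition disj (A B : pred {set T}) : pred {set T} :=
  fun G => [exists H : {set T}, [&& H \subset G, A H & B (G :\: H)]].

Lemma disjP A B G :
  reflect (exists H, [/\ H \subset G, A H & B (G :\: H)]) (disj A B G).
Proof. exact: 'exists_and3P. Qed.

Lemma disj_setU1 e A B G : e \notin G -> disj A B (e |: G) ->
  disj (fun H => A (e |: H)) B G \/ disj A (fun H => B (e |: H)) G.
Proof.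
move=> eG /disjP[H [HG AH BH]]; have [eH|eH] := boolP (e \in H); [left|right].
  apply/disjP; exists (H :\ e); split; rewrite ?setD1K ?subDset //.
  congr B: BH; apply/setP => i; rewrite !inE.
  by case: eqP => // ->; rewrite eH (negPf eG).
apply/disjP; exists H; split => //.
  by move: HG; rewrite -subDset; rewrite (setDidPl _) // disjoint_sym disjoints1.
congr B: BH; apply/setP => i; rewrite !inE.
by case: eqP => // ->; rewrite eH.
Qed.

(* For p <= 1/2 the induction over edges closes without the usual
   duplication of coordinates. *)
Lemma bk E A B : p <= 1 / 2 -> incrb A -> incrb B ->
  bprob E (disj A B) <= bprob E A * bprob E B.
Proof.
case/andP: (p01) => p0 p1 p2.
elim/setU1_ind: E A B => [|e E eE IH] A B Ai Bi.
  rewrite /bprob !bexp_set0 -natrM mulnb.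
  case: disjP => [[H []]|]; last by rewrite ler0n.
  by rewrite subset0 => /eqP ->; rewrite setD0 => -> ->.
set A1 := fun H => A (e |: H); set B1 := fun H => B (e |: H).
have A1i : incrb A1 by exact: incrb_setU1.
have B1i : incrb B1 by exact: incrb_setU1.
rewrite /bprob !bexp_setU1 // -/(bprob E A) -/(bprob E B) -/(bprob E A1)
  -/(bprob E B1) -/(bprob E (disj A B)).
(* An open [e] serves either [A] or [B]. If the events occur disjointly without [e], then both
   options are available, whence the subtraction. *)
have disjE : bexp E (fun G => (disj A B (e |: G))%:R)
   <= bprob E (disj A1 B) + bprob E (disj A B1) - bprob E (disj A B).
  rewrite -bexpD -bexpN -bexpD; apply: le_bexp => G; rewrite powersetE => GE.
  have eG : e \notin G by apply: contra eE; apply: subsetP.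
  have disj0 : disj A B G -> disj A1 B G && disj A B1 G.
    case/disjP => H [HG AH BH]; apply/andP; split; apply/disjP; exists H;
    split => //; [apply: Ai AH|apply: Bi BH]; exact: subsetUr.
  have indic (x a b c : bool) : (c -> a && b) -> (x -> a \/ b) ->
      x%:R <= a%:R + b%:R - c%:R :> R.
    move: x a b c => [] [] [] [] /= h1 h2;
      first [lra | by move: (h1 isT) | by case: (h2 isT)].
  by apply: indic => //; exact: disj_setU1.
have A01 : bprob E A <= bprob E A1 by apply: bexp_le_setU1; exact: incrbP.
have B01 : bprob E B <= bprob E B1 by apply: bexp_le_setU1; exact: incrbP.
(* After [disjE] is inserted, the disjoint occurrence without [e] has the coefficient [1 - 2 * p],
   and the bound holds with the slack [p ^+ 2] times the product of the two increments. *)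
have q0 : 0 <= 1 - 2 * p by lra.
have h0 := ler_wpM2l q0 (IH A B Ai Bi).
have h1 := ler_wpM2l p0 (IH A1 B A1i Bi).
have h2 := ler_wpM2l p0 (IH A B1 Ai B1i).
have h3 := ler_wpM2l p0 disjE.
have : 0 <= p ^+ 2 * ((bprob E A1 - bprob E A) * (bprob E B1 - bprob E B)).
  by rewrite !mulr_ge0 ?subr_ge0.
lra.
Qed.

Lemma bexp_subset E F f : F \subset E ->
  bexp E (fun G => (F \subset G)%:R * f G) =
  p ^+ #|F| * bexp (E :\: F) (fun G => f (F :|: G)).
Proof.
elim/setU1_ind: F E f => [|e F eF IH] E f FE.
  rewrite cards0 mul1r setD0; apply: eq_bexp => G _.
  by rewrite sub0set mul1r set0U.
move: FE; rewrite subUset sub1set => /andP[eE FE].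
rewrite -{1}(setD1K eE) bexp_setU1 ?setD11 //.
have -> : bexp (E :\ e) (fun G => (e |: F \subset G)%:R * f G) = 0.
  rewrite -(bexp_cst (E :\ e) 0); apply: eq_bexp => G; rewrite powersetE => GE.
  rewrite subUset sub1set.
  have /negPf -> : e \notin G.
    by apply/negP => /(subsetP GE); rewrite setD11.
  by rewrite mul0r.
rewrite mulr0 addr0 cardsU1 eF exprS -mulrA; congr (_ * _).
have FE' : F \subset E :\ e by rewrite subsetD1 FE.
have -> : E :\: (e |: F) = (E :\ e) :\: F by rewrite setDDl.
transitivity (bexp (E :\ e) (fun G => (F \subset G)%:R * f (e |: G))).
  apply: eq_bexp => G _; congr ((nat_of_bool _)%:R * _).
  rewrite subUset sub1set setU11 /=.
  apply/idP/idP => [FG|FG]; last exact: subset_trans FG (subsetUr _ _).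
  move: FG; rewrite -subDset; rewrite (setDidPl _) //.
  by rewrite disjoint_sym disjoints1.
rewrite IH //; congr (_ * _); apply: eq_bexp => G _.
by rewrite setUA.
Qed.

(* Split A according to the first of its witnesses which is open: to be the
   first one is a decreasing event for the remaining edges. *)
Lemma bprob_witness E (A W : pred {set T}) (Q : pred {set T}) (d : R) :
    incrb A -> incrb W ->
    (forall G, G \subset E -> A G -> exists F, [/\ F \subset G, A F & Q F]) ->
    (forall F, F \subset E -> A F -> Q F ->
       bprob (E :\: F) (fun G => W (F :|: G)) <= d) ->
  bprob E (fun G => A G && W G) <= d * bprob E A.
Proof.
move=> Ai Wi AQ Wd.
pose l := [seq F : {set T} <- enum {set T} | [&& F \subset E, A F & Q F]].
have lP (F : {set T}) : F \in l -> [/\ F \subset E, A F & Q F].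
  by rewrite mem_filter => /andP[/and3P].
pose some_in (l : seq {set T}) (G : {set T}) := has (fun F : {set T} => F \subset G) l.
have -> : bprob E A = bprob E (some_in l).
  apply: eq_bexp => G; rewrite powersetE => GE; congr (nat_of_bool _)%:R.
  apply/idP/hasP => [/(AQ G GE)[F [FG AF QF]]|[F /lP[_ AF _] FG]].
    exists F => //; rewrite mem_filter mem_enum AF QF !andbT.
    exact: subset_trans FG GE.
  exact: Ai AF.
have : bprob E (fun G => A G && W G) <= bprob E (fun G => some_in l G && W G).
  apply: le_bprob => G GE /andP[/(AQ G GE)[F [FG AF QF]] ->]; rewrite andbT.
  apply/hasP; exists F => //; rewrite mem_filter mem_enum AF QF !andbT.
  exact: subset_trans FG GE.
move/le_trans; apply; elim: (l) lP => [_|F l' IH lP].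
  by rewrite /bprob /some_in /= !bexp_cst mulr0.
have [FE AF QF] := lP F (mem_head _ _).
have {}IH : bprob E (fun G => some_in l' G && W G) <= d * bprob E (some_in l').
  by apply: IH => H Hl; apply: lP; rewrite in_cons Hl orbT.
(* [F] is the selected witness when none of [l'] is open. Once [F] is open, this is a decreasing
   event in the other edges, so Harris' inequality separates it from [W]. *)
pose none (G : {set T}) : R := (~~ some_in l' G)%:R.
have noneD : increasing (fun G => - none (F :|: G)).
  move=> G H GH; rewrite lerN2 /none /some_in.
  have : has (fun K : {set T} => K \subset F :|: G) l' ->
         has (fun K : {set T} => K \subset F :|: H) l'.
    case/hasP => K Kl KG; apply/hasP; exists K => //.
    exact: subset_trans KG (setUS _ GH).
  by do 2!case: has => //=; move=> /(_ isT).
have -> : bprob E (fun G => some_in (F :: l') G && W G) =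
    bprob E (fun G => some_in l' G && W G) +
    bexp E (fun G => (F \subset G)%:R * ((W G)%:R * none G)).
  rewrite -bexpD; apply: eq_bexp => G _; rewrite /none /some_in /=.
  by case: (F \subset G); case: has; case: (W G) => /=;
     rewrite ?mul0r ?mul1r ?mulr0 ?addr0 ?add0r.
have -> : bprob E (some_in (F :: l')) =
    bprob E (some_in l') + bexp E (fun G => (F \subset G)%:R * none G).
  rewrite -bexpD; apply: eq_bexp => G _; rewrite /none /some_in /=.
  by case: (F \subset G); case: has => /=;
     rewrite ?mul0r ?mul1r ?mulr0 ?addr0 ?add0r.
rewrite mulrDr lerD // !bexp_subset // mulrCA ler_wpM2l //.
  by rewrite exprn_ge0; case/andP: p01.
have WFi : increasing (fun G => (W (F :|: G))%:R).
  by move=> G H GH; apply: incrbP => //; exact: setUS.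
apply: (le_trans (harris_dec (E :\: F) WFi noneD)).
by apply: ler_wpM2r; [apply: bexp_ge0 => G; rewrite /none | exact: Wd].
Qed.

Lemma bprob_markov (I : finType) E (A : pred {set T}) (F : I -> pred {set T}) r :
  (forall G, G \subset E -> A G -> (r <= #|[set i | F i G]|)%N) ->
  r%:R * bprob E A <= \sum_i bprob E (F i).
Proof.
move=> AF; rewrite -bexpZ -bexp_sum; apply: le_bexp => G; rewrite powersetE => GE.
rewrite -natr_sum -natrM ler_nat.
have -> : (\sum_i F i G = #|[set i | F i G]|)%N.
  by rewrite -sum1dep_card [RHS]big_mkcond; apply: eq_bigr => i _; case: (F i G).
by case AG: (A G); rewrite ?muln0 // muln1; exact: AF.
Qed.

End BernoulliExpectation.

(** * Trails of length h and critical branching *)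

Section Trails.
Variable (V : finType).
Implicit Types (G H F : {set V * V}) (u v w : V) (k : nat).

Definition dedge (d : bool) v u : V * V := if d then (v, u) else (u, v).

(* A trail of G with k edges starts at v (if d = true) or ends at v (if
   d = false). *)
Fixpoint trail (d : bool) k v G : bool :=
  if k is k'.+1 then
    [exists u, (dedge d v u \in G) && trail d k' u (G :\ dedge d v u)]
  else true.

Lemma trail_incr d k v : incrb (trail d k v).
Proof.
elim: k v => //= k IH v G H GH /existsP[u /andP[uG uk]].
apply/existsP; exists u; rewrite (subsetP GH) //=.
exact: IH (setSD _ GH) uk.
Qed.

(** Supplies witnesses with few edges for the conditioning in [bprob_witness]. *)
Lemma trail_witness d k v G : trail d k v G ->
  exists F, [/\ F \subset G, trail d k v F & (#|F| <= k)%N].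
Proof.
elim: k v G => [|k IH] v G /=; first by exists set0; rewrite sub0set cards0.
case/existsP => u /andP[uG /IH[F [FG Fk cF]]].
exists (dedge d v u |: F); split.
- by rewrite subUset sub1set uG (subset_trans FG) ?subsetDl.
- apply/existsP; exists u; rewrite setU11 setU1K //.
  by apply/negP => /(subsetP FG); rewrite setD11.
- by rewrite cardsU1; case: (_ \notin _) => //=; rewrite ?add1n ?ltnS ?add0n ?leqW.
Qed.

Lemma disj_trail_witness d d' k k' v v' G :
    disj (trail d k v) (trail d' k' v') G ->
  exists F, [/\ F \subset G, disj (trail d k v) (trail d' k' v') F &
    (#|F| <= k + k')%N].
Proof.
case/disjP => H [HG /trail_witness[F [FH Fk cF]] /trail_witness[F' [FH' Fk' cF']]].
exists (F :|: F'); split.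
- rewrite subUset (subset_trans FH HG) (subset_trans FH') // subsetDl //.
- apply/disjP; exists F; split; rewrite ?subsetUl //.
  apply: trail_incr Fk'; rewrite setDUl setDv set0U.
  apply/subsetP => e eF'; rewrite !inE eF' andbT; apply/negP => /(subsetP FH).
  by move/(subsetP FH'): eF'; rewrite inE => /andP[/negPf->].
- by apply: leq_trans (leq_card_setU _ _) (leq_add cF cF').
Qed.

Lemma disj_incr A B : incrb A -> @incrb (V * V)%type B -> incrb (disj A B).
Proof.
move=> Ai Bi G H GH /disjP[F [FG AF BF]]; apply/disjP; exists F; split => //.
  exact: subset_trans FG GH.
exact: Bi (setSD _ GH) BF.
Qed.

End Trails.

Section TrailProbability.
Variables (R : realType) (V : finType) (p : R).
Hypothesis p01 : 0 <= p <= 1.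
Implicit Types (E G : {set V * V}) (b : R).

(** The complements are decreasing events, hence positively correlated by Harris' inequality:
    jointly they are at least as likely as under independence. *)
Lemma bprob_none (I : eqType) (l : seq I) E (A : I -> pred {set V * V}) q :
    q <= 1 -> (forall i, incrb (A i)) ->
    (forall i, bprob p E (A i) <= q) ->
  (1 - q) ^+ size l <= bprob p E (fun G => ~~ has (fun i => A i G) l).
Proof.
move=> q1 Ai Aq; elim: l => [|i l IH].
  by rewrite /bprob /= bexp_cst.
rewrite exprS -/(size l).
have hi : increasing (fun G => - (~~ has (fun i => A i G) l)%:R : R).
  move=> G H GH; rewrite lerN2.
  have : has (fun i => A i G) l -> has (fun i => A i H) l.
    by apply: sub_has => j; apply: Ai.
  by do 2!case: has => //=; move=> /(_ isT).
have ai : increasing (fun G => - (~~ A i G)%:R : R).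
  move=> G H GH; rewrite lerN2.
  by have := Ai i G H GH; do 2!case: (A i _) => //=; move=> /(_ isT).
have := harris p01 E ai hi; rewrite !bexpN mulrNN.
rewrite (_ : bexp _ _ (fun G => - _ * - _) =
  bprob p E (fun G => ~~ has (fun i => A i G) (i :: l))); last first.
  by apply: eq_bexp => G _; rewrite mulrNN -natrM mulnb /= negb_or.
apply: le_trans; apply: ler_pM => //; rewrite ?subr_ge0 ?exprn_ge0 ?subr_ge0 //.
rewrite lerBlDr -lerBlDl; apply: le_trans (Aq i).
rewrite -{1}(bexp_cst p E 1) -bexpN -bexpD; apply: le_bexp => // G _.
by case: (A i G); rewrite /= ?subrr ?subr0.
Qed.

(** One generation of a branching process with [n] potential children. Each first step succeeds with
    probability at most [p * b], and [bprob_none] handles the dependence between different first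
    steps. *)
Lemma bprob_trailS d k b (n : nat) : (#|V| <= n)%N -> 0 <= b <= 1 ->
    (forall E v, bprob p E (trail d k v) <= b) ->
  forall E v, bprob p E (trail d k.+1 v) <= 1 - (1 - p * b) ^+ n.
Proof.
case/andP: (p01) => p0 p1 Vn /andP[b0 b1] IH E v.
pose A u G := (dedge d v u \in G) && trail d k u (G :\ dedge d v u).
have Ai u : incrb (A u).
  move=> G H GH /andP[eG uG]; rewrite /A (subsetP GH) //=.
  exact: trail_incr (setSD _ GH) uG.
have pb1 : p * b <= 1 by rewrite mulr_ile1.
have Aq u : bprob p E (A u) <= p * b.
  have [eE|eE] := boolP (dedge d v u \in E); last first.
    apply: le_trans (_ : 0 <= _); last by rewrite mulr_ge0.
    rewrite -(bexp_cst p E 0); apply: le_bexp => // G; rewrite powersetE => GE.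
    rewrite /A; case: (boolP (_ \in G)) => //= eG.
    by rewrite (subsetP GE _ eG) in eE.
  (* The rest of the trail avoids its first edge, hence lives on a smaller edge set; this is why the
     hypothesis is uniform in [E]. *)
  have := @bexp_subset R _ p E [set dedge d v u]
    (fun G => (trail d k u (G :\ dedge d v u))%:R).
  rewrite sub1set cards1 expr1 => /(_ eE) Ee.
  have -> : bprob p E (A u) = bexp p E (fun G => ([set dedge d v u] \subset G)%:R *
      (trail d k u (G :\ dedge d v u))%:R).
    by apply: eq_bexp => G _; rewrite sub1set -natrM mulnb.
  rewrite Ee; apply: ler_wpM2l => //; apply: le_trans (IH (E :\ dedge d v u) u).
  apply: le_bprob => // G GE; apply: trail_incr.
  by rewrite subDset.
have := bprob_none (enum V) pb1 Ai Aq; rewrite -cardE => none.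
have le1 : (1 - p * b) ^+ n <= (1 - p * b) ^+ #|V|.
  by apply: ler_wiXn2l => //; rewrite ?subr_ge0 // gerBl mulr_ge0.
have -> : bprob p E (trail d k.+1 v) =
    1 - bprob p E (fun G => ~~ has (fun u => A u G) (enum V)).
  rewrite -{1}(bexp_cst p E 1) -bexpN -bexpD; apply: eq_bexp => G _ /=.
  have -> : [exists u, A u G] = has (fun u => A u G) (enum V).
    apply/existsP/hasP => [[u uA]|[u _ uA]]; exists u => //.
    by rewrite mem_enum.
  by case: has; rewrite /= ?subrr ?subr0.
rewrite lerB //; exact: le_trans le1 none.
Qed.

End TrailProbability.

(** * Survival of a nearly critical branching process *)

Section CriticalBranching.
Variable R : realType.

(** The denominator accounts for multiple successes, which the union bound [n.+1 * q] ignores. This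
    gain makes a critical process die out at rate [1 / k]. *)
Lemma one_minus_expr_le (q : R) n : 0 <= q <= 1 ->
  1 - (1 - q) ^+ n.+1 <= n.+1%:R * q / (1 + n%:R * q / 2).
Proof.
case/andP => q0 q1.
have den m : 0 < 1 + m%:R * q / 2 by rewrite ltr_wpDr // !mulr_ge0 // ler0n.
rewrite ler_pdivlMr //.
suff H : 1 - (n%:R + 2) * q / 2 <= (1 - q) ^+ n.+1 * (1 + n%:R * q / 2).
  by move: H; rewrite -[n.+1%:R]natr1; set X := _ ^+ _; set m : R := n%:R; lra.
elim: n => [|n IH]; first by rewrite expr1; lra.
have q1' : 0 <= 1 - q by rewrite subr_ge0.
have {}IH := ler_wpM2l q1' IH.
have {}IH : (1 - q) * (1 - (n%:R + 2) * q / 2) / (1 + n%:R * q / 2) <=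
    (1 - q) ^+ n.+2.
  by rewrite ler_pdivrMr // [_ ^+ n.+2]exprS -[_ * _ ^+ _ * _]mulrA.
apply: le_trans (ler_wpM2r (ltW (den n.+1)) IH).
rewrite [leRHS]mulrAC ler_pdivlMr //.
have : 0 <= q ^+ 3 * (n.+1%:R * n.+2%:R) / 4 by rewrite !mulr_ge0 ?exprn_ge0.
rewrite -[n.+2%:R]natr1 -[n.+1%:R]natr1; set m : R := n%:R; lra.
Qed.

(* If b_k bounds the probability of a trail of length k, then 1 / b_k grows
   by at least 1 / 4 in each step when mu = 1. *)
Lemma bprob_trail_decay (V : finType) (p mu : R) (n k : nat) (d : bool) :
    (0 < n)%N -> (#|V| <= n.+1)%N -> 0 <= p <= 1 ->
    1 <= mu <= n.+1%:R -> p <= mu / n.+1%:R ->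
  forall (E : {set V * V}) v, k%:R * bprob p E (trail d k v) <= 4 * mu ^+ k.
Proof.
move=> n0 Vn p01 /andP[mu1 mun] pmu.
have mu0 : 0 <= mu by exact: le_trans mu1.
suff [b [/andP[b0 b1] Hb kb]] : exists b, [/\ 0 <= b <= 1,
    forall E v, bprob p E (@trail V d k v) <= b & k%:R * b <= 4 * mu ^+ k].
  by move=> E v; apply: le_trans (ler_wpM2l (ler0n _ k) (Hb E v)) kb.
case/andP: (p01) => p0 p1.
elim: k => [|k [b [/andP[b0 b1] Hb kb]]].
  exists 1; split; rewrite ?ler01 ?lexx //; last by rewrite mul0r mulr_ge0.
  by move=> E v; apply: bprob_le1.
have b01 : 0 <= b <= 1 by rewrite b0.
have pb0 : 0 <= p * b by rewrite mulr_ge0.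
have pb1 : p * b <= 1 by rewrite mulr_ile1.
exists (1 - (1 - p * b) ^+ n.+1); split.
- rewrite subr_ge0 exprn_ile1 ?subr_ge0 ?gerBl //=.
  by rewrite exprn_ge0 ?subr_ge0.
- exact: bprob_trailS.
pose q := mu / n.+1%:R * b.
have n1 : 0 < n.+1%:R :> R by rewrite ltr0n.
have q0 : 0 <= q by rewrite mulr_ge0 // divr_ge0 // ltW.
have q1 : q <= 1.
  rewrite mulr_ile1 ?divr_ge0 ?ler0n //.
  by rewrite ler_pdivrMr // mul1r.
have pq : p * b <= q by exact: ler_wpM2r.
have le1 : 1 - (1 - p * b) ^+ n.+1 <= mu * b / (1 + b / 4).
  apply: le_trans (_ : 1 - (1 - q) ^+ n.+1 <= _).
    by rewrite lerD2l lerN2 lerXn2r ?nnegrE ?subr_ge0 // lerD2l lerN2.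
  apply: le_trans (one_minus_expr_le n _) _; first by rewrite q0.
  have -> : n.+1%:R * q = mu * b by rewrite /q; field; rewrite lt0r_neq0.
  apply: ler_wpM2l; first by rewrite mulr_ge0.
  rewrite lef_pV2 ?posrE; [|by rewrite ltr_wpDr // !mulr_ge0 ?ler0n|
    by rewrite ltr_wpDr // !mulr_ge0 ?ler0n].
  rewrite lerD2l.
  (* Since [n] and [mu] are at least 1, [n * mu / (n + 1)] is at least 1/2; this yields the [b / 4]
     of [le1]. *)
  have : 1 / 2 * b <= n%:R * q.
    have -> : n%:R * q = (n%:R * mu / n.+1%:R) * b by rewrite /q; ring.
    apply: ler_wpM2r => //; rewrite ler_pdivlMr //.
    have : 1 <= n%:R :> R by rewrite ler1n.
    rewrite -[n.+1%:R]natr1; nra.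
  lra.
apply: le_trans (ler_wpM2l (ler0n _ k.+1) le1) _.
rewrite mulrA ler_pdivrMr; last by rewrite ltr_wpDr // mulr_ge0.
have muk : 1 <= mu ^+ k by rewrite exprn_ege1.
have h1 := ler_wpM2l mu0 kb.
have h2 : mu * b <= mu * b * mu ^+ k by rewrite ler_peMr // mulr_ge0.
rewrite exprS -[k.+1%:R]natr1; move: h1 h2; set x := mu ^+ k; set m : R := k%:R.
lra.
Qed.

End CriticalBranching.

(** * Exploration of the vertices which can be reached *)

Lemma bexp_exprn (R : realType) (p : R) (T : finType) (E : {set T}) (z : R) :
  bexp p E (fun G => z ^+ #|G|) = (1 - p + p * z) ^+ #|E|.
Proof.
elim/setU1_ind: E => [|e E eE IH]; first by rewrite bexp_set0 cards0.
rewrite bexp_setU1 // IH cardsU1 eE exprS.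
rewrite (_ : bexp p E (fun G => z ^+ #|e |: G|) = z * (1 - p + p * z) ^+ #|E|).
  by ring.
rewrite -IH -bexpZ; apply: eq_bexp => G; rewrite powersetE => GE.
rewrite cardsU1 (_ : e \notin G) ?exprS //.
by apply: contra eE; exact: subsetP.
Qed.

Section Exploration.
Variable (V : finType).
Implicit Types (E F G H : {set V * V}) (A U S N : {set V}) (s : nat).

(* Some S in U is such that no edge goes from A :|: S to the rest of U, and
   A :|: S has less than s elements: fewer than s vertices can be reached from
   A inside A :|: U. *)
Definition tiny s A U G :=
  [exists S : {set V}, [&& S \subset U,
    [forall a in A :|: S, forall u in U :\: S, (a, u) \notin G] &
    (#|A| + #|S| < s)%N]].

Lemma tinyP s A U G : reflect
  (exists S, [/\ S \subset U,
     forall a u, a \in A :|: S -> u \in U :\: S -> (a, u) \notin G &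
     (#|A| + #|S| < s)%N]) (tiny s A U G).
Proof.
apply: (iffP existsP) => -[S].
  move=> /and3P[SU /'forall_implyP clS ltS]; exists S; split => // a u aS uS.
  by have /'forall_implyP := clS a aS; exact.
move=> [SU clS ltS]; exists S; apply/and3P; split => //.
by apply/'forall_implyP => a aS; apply/'forall_implyP => u uS; exact: clS.
Qed.

Lemma tiny_sub s A U G H :
    (forall a u, a \in A :|: U -> u \in U -> (a, u) \in H -> (a, u) \in G) ->
  tiny s A U G -> tiny s A U H.
Proof.
move=> HG /tinyP[S [SU clS ltS]]; apply/tinyP; exists S; split => // a u aS uS.
have uU : u \in U by case/setDP: uS.
apply: contra (clS a u aS uS); apply: HG => //.
by move: aS; rewrite !inE => /orP[->//|/(subsetP SU) ->]; rewrite orbT.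
Qed.

Lemma tiny_decr s A U G H : G \subset H -> tiny s A U H -> tiny s A U G.
Proof. by move=> GH; apply: tiny_sub => a u _ _; exact: (subsetP GH). Qed.

Lemma card_explored A U a N : a \in A -> [disjoint A & U] -> N \subset U ->
  [/\ #|A :\ a :|: N| = (#|A|.-1 + #|N|)%N, #|U :\: N| = (#|U| - #|N|)%N &
     [disjoint A :\ a :|: N & U :\: N]].
Proof.
move=> aA dAU NU; have dN : (A :\ a) :&: N = set0.
  apply/eqP; rewrite -subset0; apply/subsetP => u /setIP[/setD1P[_ uA] uN].
  by move: dAU; rewrite disjoint_subset => /subsetP/(_ u uA);
    rewrite !inE (subsetP NU u uN).
split; first by rewrite cardsU dN cards0 subn0 (cardsD1 a A) aA.
  by rewrite cardsD (setIidPr NU).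
rewrite -setI_eq0 -subset0; apply/subsetP => u; rewrite !inE => /andP[].
case/orP => [/andP[_ uA]|-> //] /andP[_ uU].
by move: dAU; rewrite disjoint_subset => /subsetP/(_ u uA); rewrite inE uU.
Qed.

(** One exploration step: [a] is used up, at the cost of one unit of [s], and its unexplored
    out-neighbours [N], which every admissible [S] must contain, become active. *)
Lemma tinyS s A U G a : a \in A -> [disjoint A & U] ->
  let N := [set u in U | (a, u) \in G] in
  tiny s.+1 A U G = tiny s (A :\ a :|: N) (U :\: N) G.
Proof.
move=> aA dAU N.
have NU : N \subset U by apply/subsetP => u; rewrite inE => /andP[].
have [cN _ _] := card_explored aA dAU NU.
have A0 : (0 < #|A|)%N by rewrite (cardsD1 a) aA.
apply/tinyP/tinyP => -[S [SU clS ltS]].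
  have NS : N \subset S.
    apply/subsetP => u; rewrite inE => /andP[uU auG]; apply/negPn/negP => uS.
    by have := clS a u; rewrite !inE aA uS uU auG /= => /(_ isT isT).
  exists (S :\: N); split; first exact: setSD.
    move=> b u; rewrite !inE => bA /andP[uS /andP[uN uU]]; apply: clS.
      rewrite !inE; case: (b \in A) bA => //=; rewrite andbF /=.
      by case/orP => [bN|/andP[]//]; apply: (subsetP NS); rewrite inE.
    rewrite !inE uU andbT; apply: contra uS => ->; rewrite andbT.
    by move: uN.
  rewrite cN cardsD (setIidPr NS); have := subset_leq_card NS.
  by move: ltS; lia.
have SN : S :&: N = set0.
  apply/eqP; rewrite -subset0; apply/subsetP => u /setIP[/(subsetP SU)].
  by rewrite inE => /andP[/negPf->].
exists (S :|: N); split.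
- by rewrite subUset NU (subset_trans SU) ?subsetDl.
- move=> b u bA uS; have [->|ba] := eqVneq b a.
    move: uS; rewrite !inE negb_or => /andP[/andP[_ uN] uU].
    by move: uN; rewrite uU.
  apply: clS; last by move: uS; rewrite !inE negb_or => /andP[/andP[-> ->] ->].
  by move: bA; rewrite !inE ba /= => /or3P[->|->|->]; rewrite ?orbT.
- by rewrite cardsU SN cards0 subn0; move: ltS; rewrite cN; lia.
Qed.

Variable R : realType.
Variable p : R.
Hypothesis p01 : 0 <= p <= 1.

(** Only the edges [F] from [a] to [U] are revealed. The later exploration no longer contains [a],
    so it depends only on the edges outside [F], which are independent of [F]. *)
Lemma bprob_tinyS s A U E a : a \in A -> [disjoint A & U] ->
  let F := [set e in E | (e.1 == a) && (e.2 \in U)] in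
  let N H := [set u | (a, u) \in H] in
  bprob p E (tiny s.+1 A U) = bexp p F (fun H =>
    bprob p (E :\: F) (tiny s (A :\ a :|: N H) (U :\: N H))).
Proof.
move=> aA dAU F N.
have FE : F \subset E by apply/subsetP => e; rewrite inE => /andP[].
have dF : [disjoint F & E :\: F].
  by rewrite -setI_eq0; apply/eqP/setP => e; rewrite !inE; case: (_ \in E);
    case: (_ == a); case: (_ \in U).
have UE : F :|: (E :\: F) = E.
  by apply/setP => e; rewrite !inE; case: (_ \in E); rewrite ?andbF //= andbT orbN.
rewrite -{1}UE /bprob bexpU //; apply: eq_bexp => H; rewrite powersetE => HF.
apply: eq_bexp => G; rewrite powersetE => GE; congr ((nat_of_bool _)%:R).
rewrite (tinyS s _ aA) //.
have -> : [set u in U | (a, u) \in H :|: G] = N H.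
  apply/setP => u; rewrite !inE.
  have HU : (a, u) \in H -> u \in U.
    by move=> /(subsetP HF); rewrite inE /= => /and3P[].
  case: (boolP (u \in U)) => uU /=; last by apply/esym/negP => /HU; exact/negP.
  case: (boolP (_ \in G)) => [/(subsetP GE)|_]; last by rewrite orbF.
  by rewrite !inE eqxx uU /= andbT andNb.
have aU : a \notin U.
  by move: dAU; rewrite disjoint_subset => /subsetP/(_ a aA); rewrite inE.
apply/idP/idP; apply: tiny_sub => b u.
  by rewrite [(b, u) \in _ :|: _]inE => _ _ ->; rewrite orbT.
move=> bA _; rewrite inE => /orP[/(subsetP HF)|//]; rewrite inE /=.
case/and3P => _ /eqP ba _; move: bA; rewrite ba !inE eqxx /= (negPf aU) andbF orbF.
move=> /(subsetP HF); rewrite inE /= => /and3P[_ _ aU'].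
by rewrite aU' in aU.
Qed.

Lemma card_out (E : {set V * V}) U a (H : {set V * V}) :
  H \subset [set e in E | (e.1 == a) && (e.2 \in U)] ->
  #|[set u | (a, u) \in H]| = #|H| /\ [set u | (a, u) \in H] \subset U.
Proof.
move=> HF; split; last first.
  by apply/subsetP => u; rewrite inE => /(subsetP HF); rewrite inE => /and3P[].
rewrite -(card_imset (mem [set u | (a, u) \in H]) (f := pair a)); last by move=> u w [].
congr #|pred_of_set _|; apply/setP => e; apply/imsetP/idP => [[u]|eH].
  by rewrite inE => ? ->.
have := subsetP HF e eH; rewrite inE => /and3P[_ /eqP ea _].
by exists e.2; rewrite ?inE -ea -surjective_pairing.
Qed.

(* Explore s vertices. If this is possible, then at least s - #|A| vertices are
   found on the way; the i-th explored vertex (i < s) finds at most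
   #|A| + #|U| - i.+1 vertices, each with probability p. *)
Lemma bprob_not_tiny (th : R) s A U E : 0 <= th -> [disjoint A & U] ->
  bprob p E (fun G => ~~ tiny s A U G) <=
  expR (th * (#|A|%:R - s%:R) +
        (expR th - 1) * p * \sum_(i < s) (#|A| + #|U| - i.+1)%:R).
Proof.
case/andP: (p01) => p0 p1 th0.
have eth0 : 0 <= expR th - 1 by rewrite subr_ge0 -expR0 ler_expR.
elim: s A U E => [|s IH] A U E dAU.
  apply: le_trans (bprob_le1 p01 _ _) _.
  by rewrite big_ord0 mulr0 addr0 subr0 -expR0 ler_expR mulr_ge0.
have [A0|[a aA]] := set_0Vmem A.
  apply: le_trans (expR_ge0 _).
  rewrite -(bexp_cst p E 0); apply: le_bexp => // G _.
  suff -> : tiny s.+1 A U G by [].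
  apply/tinyP; exists set0; split; rewrite ?sub0set // ?A0 ?cards0 //.
  by move=> b u; rewrite !inE.
set F := [set e in E | (e.1 == a) && (e.2 \in U)].
pose N (H : {set V * V}) := [set u | (a, u) \in H].
have -> : bprob p E (fun G => ~~ tiny s.+1 A U G) = bexp p F (fun H =>
    bprob p (E :\: F) (fun G => ~~ tiny s (A :\ a :|: N H) (U :\: N H) G)).
  have negE (E' : {set V * V}) (B : pred {set V * V}) :
      bprob p E' (fun G => ~~ B G) = 1 - bprob p E' B.
    rewrite -[X in X - _](bexp_cst p E' 1) -bexpN -bexpD; apply: eq_bexp => G _.
    by case: (B G); rewrite /= ?subrr ?subr0.
  rewrite negE (bprob_tinyS s E aA dAU) -[X in X - _](bexp_cst p F 1).
  by rewrite -bexpN -bexpD; apply: eq_bexp => H _; rewrite negE.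
have A0 : (0 < #|A|)%N by rewrite (cardsD1 a) aA.
set v := (#|A| + #|U|)%N.
(* The exponent of the induction hypothesis without the new vertices; each of these contributes a
   further factor [expR th]. *)
pose c := th * (#|A|%:R - s.+1%:R) +
  (expR th - 1) * p * \sum_(i < s) (v.-1 - i.+1)%:R.
apply: le_trans (_ : bexp p F (fun H => expR c * expR th ^+ #|H|) <= _).
  apply: le_bexp => // H; rewrite powersetE => /card_out[cN NU].
  have [cA cU dA] := card_explored aA dAU NU.
  apply: le_trans (IH _ _ _ dA) _.
  rewrite -expRM_natl -expRD ler_expR cA cU -cN -/(N H).
  have leN := subset_leq_card NU; rewrite -/(N H) in leN.
  have -> : (#|A|.-1 + #|N H| + (#|U| - #|N H|) = v.-1)%N by rewrite /v; lia.
  rewrite /c natrD -[in leRHS](prednK A0) -!natr1; lra.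
rewrite bexpZ bexp_exprn.
have cF : (#|F| <= v.-1)%N.
  have [<- /subset_leq_card leU] := card_out (subxx F).
  by move: leU; rewrite /v; lia.
apply: le_trans (_ : expR c * expR ((expR th - 1) * p * v.-1%:R) <= _).
  apply: ler_wpM2l; first exact: expR_ge0.
  have -> : 1 - p + p * expR th = 1 + (expR th - 1) * p by ring.
  have y0 : 0 <= (expR th - 1) * p by rewrite mulr_ge0.
  apply: le_trans (_ : expR ((expR th - 1) * p) ^+ #|F| <= _).
    by apply: lerXn2r; rewrite ?nnegrE ?expR_ge0 ?addr_ge0 ?expR_ge1Dx.
  by rewrite -expRM_natr ler_expR ler_wpM2l // ler_nat.
have -> : \sum_(i < s.+1) (v - i.+1)%:R =
    v.-1%:R + \sum_(i < s) (v.-1 - i.+1)%:R :> R.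
  rewrite big_ord_recl subn1; congr (_ + _); apply: eq_bigr => i _.
  by rewrite lift0; congr (_%:R); lia.
rewrite -expRD ler_expR /c; set S := \sum_(i < s) _; set w := v.-1%:R; lra.
Qed.

(* The exponential expR (- th * #|A|) is a supermartingale of the exploration, up
   to a factor expR ka per step, as long as at least q vertices are unexplored. *)
Lemma bprob_tiny (th ka : R) q s A U E : 0 <= th -> 0 <= ka ->
    th - p * q%:R * (1 - expR (- th)) <= ka ->
    [disjoint A & U] -> (q + s <= #|A| + #|U|)%N ->
    (forall a u, a \in A :|: U -> u \in U -> a != u -> (a, u) \in E) ->
  bprob p E (tiny s A U) <= expR (- (th * #|A|%:R) + ka * s%:R).
Proof.
case/andP: (p01) => p0 p1 th0 ka0 kaq.
have eth0 : 0 <= 1 - expR (- th) by rewrite subr_ge0 -expR0 ler_expR oppr_le0.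
elim: s A U E => [|s IH] A U E dAU qs EAU.
  apply: le_trans (expR_ge0 _).
  rewrite -(bexp_cst p E 0); apply: le_bexp => // G _.
  by case: tinyP => // -[S []].
have [A0|[a aA]] := set_0Vmem A.
  apply: le_trans (bprob_le1 p01 _ _) _.
  by rewrite A0 cards0 mulr0 oppr0 add0r -expR0 ler_expR mulr_ge0.
(* With more than [s] active vertices the event is impossible. Otherwise [U] still has at least [q]
   vertices, which gives [q <= #|F|] below. *)
have [As|sA] := leqP #|A| s; last first.
  apply: le_trans (expR_ge0 _).
  rewrite -(bexp_cst p E 0); apply: le_bexp => // G _.
  by case: tinyP => // -[S [_ _]]; move: sA; lia.
rewrite (bprob_tinyS s E aA dAU).
set F := [set e in E | (e.1 == a) && (e.2 \in U)].
have A0 : (0 < #|A|)%N by rewrite (cardsD1 a) aA.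
have aU : a \notin U.
  by move: dAU; rewrite disjoint_subset => /subsetP/(_ a aA); rewrite inE.
pose c := - (th * (#|A|%:R - 1)) + ka * s%:R.
apply: le_trans (_ : bexp p F (fun H => expR c * expR (- th) ^+ #|H|) <= _).
  apply: le_bexp => // H; rewrite powersetE => HF; have [cN NU] := card_out HF.
  set N := [set u | _] in cN NU *.
  have [cA cU dA] := card_explored aA dAU NU.
  have leN := subset_leq_card NU.
  apply: le_trans (IH _ _ _ dA _ _) _.
  - by rewrite cA cU; move: qs leN; lia.
  - move=> b u bAU uU bu.
    have uU' : u \in U by case/setDP: uU.
    have bA : b \in A :|: U.
      move: bAU; rewrite !inE => /orP[/orP[/andP[_ ->]//|bN]|/andP[_ ->]].
        by rewrite (subsetP NU) ?orbT // inE.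
      by rewrite orbT.
    rewrite inE EAU // andbT inE negb_and; apply/orP; right.
    rewrite negb_and; apply/orP; left; apply: contraTneq bAU => /= ->.
    rewrite !inE eqxx (negPf aU) /= andbF orbF; apply: contra aU => aH.
    by apply: (subsetP NU); rewrite inE.
  rewrite -expRM_natl -expRD ler_expR cA -cN /c natrD.
  rewrite -[in leRHS](prednK A0) -natr1; lra.
rewrite bexpZ bexp_exprn.
have cF : (q <= #|F|)%N.
  suff -> : #|F| = #|U| by move: qs As; lia.
  have [<- NU] := card_out (subxx F); congr #|pred_of_set _|.
  apply/eqP; rewrite eqEsubset NU; apply/subsetP => u uU.
  rewrite !inE eqxx uU !andbT EAU ?inE ?aA //.
  by apply: contraNneq aU => ->.
apply: le_trans (_ : expR c * expR (- (p * (1 - expR (- th)) * q%:R)) <= _).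
  apply: ler_wpM2l; first exact: expR_ge0.
  have -> : 1 - p + p * expR (- th) = 1 - p * (1 - expR (- th)) by ring.
  set y := p * _.
  have y0 : 0 <= y by rewrite mulr_ge0.
  have y1 : y <= 1 by rewrite mulr_ile1 // gerBl expR_ge0.
  apply: le_trans (_ : (1 - y) ^+ q <= _).
    by apply: ler_wiXn2l; rewrite ?subr_ge0 // gerBl.
  rewrite -[- (y * _)]mulNr expRM_natr.
  by apply: lerXn2r; rewrite ?nnegrE ?expR_ge0 ?subr_ge0 // expR_ge1Dx.
rewrite -expRD ler_expR /c -natr1; move: kaq.
set y := 1 - expR _; set z : R := q%:R; lra.
Qed.

End Exploration.

(** * Decomposition of a long trail *)

Section LongTrails.
Variable V : finType.
Implicit Types (E F G H : {set V * V}) (B S : {set V}) (s h K M : nat).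
Implicit Types (w : nat -> V) (v : V) (t : seq V).

(* Fewer than s vertices can be reached from B. *)
Definition small s B G := tiny s B (~: B) G.

Lemma smallP s B G : reflect
  (exists S, [/\ B \subset S,
     forall a u, a \in S -> u \notin S -> (a, u) \notin G & (#|S| < s)%N])
  (small s B G).
Proof.
apply: (iffP (tinyP _ _ _ _)) => -[S [BS clS ltS]].
  exists (B :|: S); split; rewrite ?subsetUl //.
    move=> a u aS uS; apply: clS => //; move: uS.
    by rewrite !inE negb_or andbC.
  by apply: leq_ltn_trans ltS; exact: leq_card_setU.
exists (S :\: B); split.
- by rewrite setDE subsetIr.
- move=> a u; rewrite !inE => aBS; rewrite negb_and negbK => /andP[uS uB].
  apply: clS; last by move: uS; rewrite (negPf uB).
  by case/orP: aBS => [/(subsetP BS)//|/andP[]].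
- suff -> : (#|B| + #|S :\: B| = #|S|)%N by [].
  by rewrite cardsD (setIidPr BS) subnKC // subset_leq_card.
Qed.

Lemma small_decr s B G H : G \subset H -> small s B H -> small s B G.
Proof. exact: tiny_decr. Qed.

(** A function on [nat] makes the subtrails intervals of indices. *)
Definition is_trail w M G :=
  (forall i, (i < M)%N -> (w i, w i.+1) \in G) /\
  (forall i j, (i < M)%N -> (j < M)%N ->
     (w i, w i.+1) = (w j, w j.+1) -> i = j).

Lemma is_trail_le w M M' G : (M' <= M)%N -> is_trail w M G -> is_trail w M' G.
Proof.
move=> MM [wG wI]; split=> [i iM|i j iM jM]; first by apply: wG; lia.
by apply: wI; lia.
Qed.

Lemma longest_trail M G : (0 < M <= longest_saop G)%N ->
  exists w, is_trail w M G.
Proof.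
case/andP => M0; rewrite /longest_saop => ML.
have [k /existsP[v /existsP[u /existsP[t /andP[/andP[tG tU] _]]]] Mk] :
    exists2 k, [exists i, exists j, has_saop G i j k] & (M <= k)%N.
  apply: contrapT => nk; move: ML; apply/negP; rewrite -ltnNge.
  elim/big_ind: _ => // [a b|k kP]; first by rewrite gtn_max => -> ->.
  by rewrite ltnNge; apply/negP => Mk; apply: nk; exists (val k).
exists (nth v (v :: t)); apply: (is_trail_le Mk).
have sz : size (zip (v :: t) t) = k by rewrite size_zip /= size_tuple minnE; lia.
have nthE i : (i < k)%N -> (nth v (v :: t) i, nth v (v :: t) i.+1) =
    nth (v, v) (zip (v :: t) t) i.
  by move=> ik; rewrite nth_zip_cond sz ik.
split=> [i ik|i j ik jk].
  by rewrite nthE //; apply: (allP tG); rewrite mem_nth ?sz.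
by rewrite !nthE // => /eqP; rewrite nth_uniq ?sz // => /eqP.
Qed.

Lemma is_trail_out w M G H i k : is_trail w M G -> (i + k <= M)%N ->
    (forall j, (i <= j < i + k)%N -> (w j, w j.+1) \in H) ->
  trail true k (w i) H.
Proof.
move=> [_ wI]; elim: k i H => //= k IH i H ikM wH.
apply/existsP; exists (w i.+1); apply/andP; split; first by apply: wH; lia.
apply: IH; first by lia.
move=> j ij; rewrite !inE wH ?andbT; last by lia.
by apply/eqP => ee; suff : j = i by [lia]; apply: wI => //; lia.
Qed.

Lemma is_trail_in w M G H i k : is_trail w M G -> (i + k <= M)%N ->
    (forall j, (i <= j < i + k)%N -> (w j, w j.+1) \in H) ->
  trail false k (w (i + k)%N) H.
Proof.
move=> [_ wI]; elim: k H => //= k IH H ikM wH.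
apply/existsP; exists (w (i + k)%N); apply/andP; split.
  by rewrite addnS; apply: wH; lia.
apply: IH; first by lia.
move=> j ij; rewrite !inE wH ?andbT; last by lia.
rewrite addnS; apply/eqP => ee; suff : j = (i + k)%N by lia.
by apply: wI => //; lia.
Qed.

Lemma is_trail_in_out w M G H i k h : is_trail w M G ->
    (h <= i)%N -> (i + k + h <= M)%N -> H \subset G ->
    (forall j, (j < M)%N -> ~~ (i <= j < i + k)%N -> (w j, w j.+1) \in H) ->
  disj (trail false h (w i)) (trail true h (w (i + k)%N)) H.
Proof.
move=> wM hi ikM HG wH.
(* The edges before position [i] witness the incoming trail; as the edges of the trail are distinct,
   the outgoing part avoids them. *)
pose F := [set (w (val j), w (val j).+1) | j : 'I_M in [pred j : 'I_M | (val j < i)%N]].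
have FP e : reflect (exists2 j, (j < M)%N && (j < i)%N & e = (w j, w j.+1)) (e \in F).
  apply: (iffP imsetP) => [[j]|[j /andP[jM ji] ->]].
    by rewrite inE => ji ->; exists (val j); rewrite ?ltn_ord.
  by exists (Ordinal jM).
apply/disjP; exists F; split.
- by apply/subsetP => e /FP[j /andP[jM ji] ->]; apply: wH => //; lia.
- have := @is_trail_in w M G F (i - h) h wM; rewrite subnK //; apply; first by lia.
  by move=> j jih; apply/FP; exists j => //; lia.
- apply: (is_trail_out wM) => [//|j ij]; rewrite inE wH ?andbT; try lia.
  apply/FP => -[j' /andP[jM' ji'] ee]; case: wM => _ wI.
  by suff : j = j' by [lia]; apply: wI => //; lia.
Qed.

Definition trail_edges v t : {set V * V} := [set e in zip (v :: t) t].

Definition wide_edge h s (e : V * V) : pred {set V * V} := fun G =>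
  [&& e \in G, disj (trail false h e.1) (trail true h e.2) (G :\ e) &
      ~~ small s [set e.2] G].

(** The exploration starts from all vertices of the trail: it is their number which makes a small
    reach unlikely. *)
Definition narrow_trail h s v t : pred {set V * V} := fun G =>
  [&& saop G v t,
      disj (trail false h v) (trail true h (last v t)) (G :\: trail_edges v t) &
      small s [set x in v :: t] G].

Lemma zip_walk w i K : zip (w i :: mkseq (fun j => w (i + j).+1) K)
    (mkseq (fun j => w (i + j).+1) K) =
  mkseq (fun j => (w (i + j)%N, w (i + j).+1)) K.
Proof.
have sz : size (zip (w i :: mkseq (fun j => w (i + j).+1) K)
    (mkseq (fun j => w (i + j).+1) K)) = K.
  by rewrite size_zip /= size_mkseq minnE; lia.
apply: (@eq_from_nth _ (w i, w i)); first by rewrite sz size_mkseq.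
rewrite sz => j jK; rewrite nth_zip_cond sz jK !nth_mkseq //; congr (_, _).
by case: j jK => [|j] jK; rewrite ?addn0 //= nth_mkseq ?addnS //; lia.
Qed.

Lemma is_trail_reach w M G S i j : is_trail w M G -> (i <= j <= M)%N ->
    (forall a u, a \in S -> u \notin S -> (a, u) \notin G) ->
  w i \in S -> w j \in S.
Proof.
move=> [wG _] ijM clS wi.
have [d jE] : exists d, j = (i + d)%N by exists (j - i)%N; lia.
rewrite {}jE in ijM *; elim: d ijM => [|d IH] ijM; rewrite ?addn0 //.
apply: contraT => wj; rewrite addnS in wj.
by have := clS _ _ (IH _) wj; rewrite wG; [move=> /(_ ltac:(lia))|lia].
Qed.

(* Let v be the vertex reached by the trail after 2h steps. If many vertices
   can be reached from v, then the same is true for all vertices before v. If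
   not, then the same is true for all sets of vertices after v. *)
Lemma is_trail_wide_or_narrow w h K s G : (0 < K)%N ->
    is_trail w (K + 4 * h) G ->
  (h <= #|[set e | wide_edge h s e G]|)%N \/
  (h <= #|[set vt : V * K.-tuple V | narrow_trail h s vt.1 vt.2 G]|)%N.
Proof.
move=> K0 wM; have [sm|nsm] := boolP (small s [set w (2 * h)%N] G); [right|left].
  have [S [wS clS ltS]] := smallP _ _ _ sm.
  (* A piece of [K] edges from position [2 * h + j] with [j < h] leaves at least [h] of the
     [K + 4 * h] edges after it. *)
  pose f (j : 'I_h) : V * K.-tuple V := (w (2 * h + j)%N,
    Tuple (introT eqP (size_mkseq (fun i => w (2 * h + j + i).+1) K))).
  (* As [0 < K], the piece has a first edge, and this edge determines its position. *)
  have f_inj : injective f.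
    move=> j j' [ej]; case: K K0 wM @f => // K _ [_ wI] f.
    rewrite /mkseq /= => -[ej' _]; apply/val_inj => /=.
    suff : (2 * h + j)%N = (2 * h + j')%N by lia.
    have := ltn_ord j; have := ltn_ord j' => *; apply: wI; try lia.
    by rewrite ej; congr (_, _); move: ej'; rewrite !addn0.
  rewrite -[X in (X <= _)%N]card_ord -cardsT -(card_imset _ f_inj).
  apply/subset_leq_card/subsetP => _ /imsetP[j _ ->]; rewrite inE /=.
  have jh := ltn_ord j; set i := (2 * h + j)%N.
  have zE := zip_walk w i K.
  have lastE : last (w i) (mkseq (fun j => w (i + j).+1) K) = w (i + K)%N.
    rewrite (last_nth (w i)) size_mkseq; case: (K) K0 => // k _.
    by rewrite /= -/(mkseq _ k.+1) nth_mkseq // addnS.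
  case: (wM) => wG wI.
  apply/and3P; split.
  - rewrite /saop zE; apply/andP; split.
      apply/allP => e /mapP[k]; rewrite mem_iota => kK ->; apply: wG; rewrite /i.
      lia.
    rewrite map_inj_in_uniq ?iota_uniq // => k k'; rewrite !mem_iota => kK kK' ee.
    by suff : (i + k)%N = (i + k')%N by [lia]; apply: wI => //; rewrite /i; lia.
  - rewrite /= lastE; apply: (is_trail_in_out wM); rewrite ?subsetDl /i; try lia.
    move=> l lM il; rewrite !inE wG // andbT /= zE; apply/mapP => -[k].
    rewrite mem_iota => kK ee; move: il; rewrite -/i.
    by suff -> : l = (i + k)%N by [lia]; apply: wI => //; rewrite /i; lia.
  - apply/smallP; exists S; split => //; apply/subsetP => x; rewrite inE.
    suff wlS l : (l <= K)%N -> w (i + l)%N \in S.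
      rewrite inE => /orP[/eqP->|/mapP[l]].
        by rewrite -[i]addn0; exact: wlS.
      by rewrite mem_iota => lK ->; rewrite -addnS; apply: wlS; lia.
    move=> lK; apply: (is_trail_reach (i := (2 * h)%N) wM) => //.
      by rewrite /i; lia.
    by apply: (subsetP wS); rewrite inE.
pose f (j : 'I_h) : V * V := (w (h + j)%N, w (h + j).+1).
case: (wM) => wG wI.
have f_inj : injective f.
  move=> j j' ee; apply/val_inj => /=.
  have := ltn_ord j; have := ltn_ord j' => *.
  by suff : (h + j)%N = (h + j')%N by [lia]; apply: wI => //; lia.
rewrite -[X in (X <= _)%N]card_ord -cardsT -(card_imset _ f_inj).
apply/subset_leq_card/subsetP => _ /imsetP[j _ ->]; rewrite inE.
have jh := ltn_ord j; apply/and3P; split; first by apply: wG; lia.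
  rewrite /= -addn1; apply: (is_trail_in_out wM); rewrite ?subD1set; try lia.
  move=> l lM il; rewrite !inE wG // andbT ?addn1; apply/eqP => ee; move: il.
  by suff -> : l = (h + j)%N by [lia]; apply: wI => //; lia.
(* A set closed under out-edges which contains the head of an earlier edge also contains
   [w (2 * h)]. *)
apply: contra nsm => /smallP[S [wS clS ltS]]; apply/smallP; exists S; split => //.
rewrite sub1set; apply: (is_trail_reach (i := (h + j).+1) wM) => //.
  by apply/andP; split; lia.
by apply: (subsetP wS); rewrite inE.
Qed.

End LongTrails.

(** * First moment bounds *)

Section FirstMoment.
Variables (R : realType) (V : finType) (p : R).
Hypothesis p01 : 0 <= p <= 1.
Implicit Types (E F G H : {set V * V}) (B S : {set V}) (s h K M : nat).
Implicit Types (v : V) (t : seq V).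

Definition all_edges : {set V * V} := [set e | e.1 != e.2].

(** The next vertex is either new, with at most [#|V|] choices and a factor [z], or a repetition,
    with at most [N] choices and no factor. This controls the trails with repeated vertices. *)
Lemma sum_exprn_card (z : R) B K N : 0 <= z -> (#|B| + K <= N.+1)%N ->
  \sum_(t : K.-tuple V) z ^+ #|B :|: [set x in t]| <=
  z ^+ #|B| * (#|V|%:R * z + N%:R) ^+ K.
Proof.
move=> z0; elim: K B => [|K IH] B BKN.
  rewrite (eq_bigr (fun=> z ^+ #|B|)) => [|t _]; last first.
    by rewrite tuple0; congr (_ ^+ #|pred_of_set _|); apply/setP => x; rewrite !inE orbF.
  by rewrite sumr_const card_tuple expn0 mulr1n expr0 mulr1.
have -> : \sum_(t : K.+1.-tuple V) z ^+ #|B :|: [set x in t]| =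
    \sum_(u : V) \sum_(t : K.-tuple V) z ^+ #|(u |: B) :|: [set x in t]|.
  rewrite pair_big /=.
  rewrite (reindex (fun ut : V * K.-tuple V => [tuple of ut.1 :: ut.2])) /=.
    apply: eq_bigr => -[u t] _; congr (_ ^+ #|pred_of_set _|).
    by apply/setP => x; rewrite !inE orbCA orbA.
  exists (fun t : K.+1.-tuple V => (thead t, [tuple of behead t])) => /=.
    by case=> u t _; congr (_, _); apply/val_inj.
  by move=> t _; rewrite -tuple_eta.
apply: le_trans (_ : \sum_(u : V) z ^+ #|u |: B| * (#|V|%:R * z + N%:R) ^+ K <= _).
  apply: ler_sum => u _; apply: IH; rewrite cardsU1.
  by case: (_ \notin _); rewrite ?add0n ?add1n; lia.
rewrite -mulr_suml exprS mulrA; apply: ler_wpM2r.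
  by rewrite exprn_ge0 // addr_ge0 ?mulr_ge0.
rewrite (bigID (mem B)) /= addrC mulrDr; apply: lerD.
  rewrite (eq_bigr (fun=> z ^+ #|B|.+1)) => [|u uB]; last by rewrite cardsU1 uB.
  rewrite sumr_const exprSr -[leLHS]mulr_natr -mulrA; apply: ler_wpM2l.
    by rewrite exprn_ge0.
  by rewrite [leRHS]mulrC ler_wpM2l // ler_nat max_card.
rewrite (eq_bigr (fun=> z ^+ #|B|)) => [|u uB]; last by rewrite cardsU1 uB.
rewrite sumr_const -[leLHS]mulr_natr ler_wpM2l ?exprn_ge0 // ler_nat.
by move: BKN; lia.
Qed.

Section Bounds.
Variables (h K s q : nat) (b th1 th2 ka : R).
Hypotheses (p2 : p <= 1 / 2) (b0 : 0 <= b)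
  (trail_b : forall E d v, bprob p E (trail d h v) <= b)
  (th1_0 : 0 <= th1) (th2_0 : 0 <= th2) (ka0 : 0 <= ka)
  (kaq : th2 - p * q%:R * (1 - expR (- th2)) <= ka) (qs : (q + s <= #|V|)%N).

Lemma bprob_disj_trail E v v' :
  bprob p E (disj (trail false h v) (trail true h v')) <= b ^+ 2.
Proof.
apply: le_trans (bk p01 _ p2 (@trail_incr _ _ _ _) (@trail_incr _ _ _ _)) _.
by rewrite expr2; apply: ler_pM => //; exact: bprob_ge0.
Qed.

Lemma bprob_subset E F (A : pred {set V * V}) (B : pred {set V * V}) :
    (forall G, G \subset E -> A G -> F \subset G /\ B G) -> F \subset E ->
  bprob p E A <= p ^+ #|F| * bprob p (E :\: F) (fun G => B (F :|: G)).
Proof.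
move=> AB FE; rewrite -(@bexp_subset _ _ _ _ _ (fun G => (B G)%:R)) //.
apply: le_bexp => // G; rewrite powersetE => /AB.
by case: (A G) => [/(_ isT)[-> ->]|_]; rewrite ?mulr1 // mulr_ge0.
Qed.

Lemma setU_setDK E F G : G \subset E :\: F -> (F :|: G) :\: F = G.
Proof.
move=> GE; rewrite setDUl setDv set0U; apply/setDidPl.
rewrite -setI_eq0 -subset0; apply/subsetP => e; rewrite inE => /andP[].
by move/(subsetP GE); rewrite inE => /andP[/negPf->].
Qed.

(** The bound of [bprob_not_tiny] for an exploration started at the at most [4 * h + 2] endpoints of
    an edge and of [2 * h] witnessing edges. *)
Definition wide_bound : R :=
  expR (th1 * ((4 * h + 2)%:R - s%:R) +
        (expR th1 - 1) * p * \sum_(i < s) (#|V| - i.+1)%:R).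

(** Two long trails and a large reach are both increasing events, so Harris' inequality has the
    wrong direction. Instead one conditions on a witness of at most [h + h] edges for the two
    trails. *)
Lemma bprob_wide_edge e :
  bprob p all_edges (wide_edge h s e) <= p * b ^+ 2 * wide_bound.
Proof.
case/andP: (p01) => p0 p1.
have w0 : 0 <= wide_bound by exact: expR_ge0.
have [eE|eE] := boolP (e \in all_edges); last first.
  apply: (@le_trans _ _ 0); last by rewrite !mulr_ge0.
  rewrite -(bexp_cst p all_edges 0); apply: le_bexp => // G.
  rewrite powersetE /wide_edge => GE; case: (boolP (e \in G)) => //= eG.
  by rewrite (subsetP GE) in eE.
pose A := disj (trail false h e.1) (trail true h e.2).
pose W G := ~~ small s [set e.2] (e |: G).
apply: le_trans (@bprob_subset _ [set e] _
    (fun G => A (G :\ e) && ~~ small s [set e.2] G) _ _) _.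
- by move=> G _ /and3P[eG AG WG]; rewrite sub1set; split=> //; apply/andP.
- by rewrite sub1set.
rewrite cards1 expr1 -mulrA; apply: ler_wpM2l => //.
have -> : bprob p (all_edges :\ e)
     (fun G => A ((e |: G) :\ e) && ~~ small s [set e.2] (e |: G)) =
   bprob p (all_edges :\ e) (fun G => A G && W G).
  apply: eq_bexp => G; rewrite powersetE => GE.
  by rewrite (setU_setDK GE).
have Ai : incrb A by apply: disj_incr; exact: trail_incr.
have Wi : incrb W.
  by move=> G H GH; apply: contra; apply: small_decr; exact: setUS.
apply: le_trans (@bprob_witness _ _ _ p01 _ A W
  (fun F => #|F| <= h + h)%N wide_bound Ai Wi _ _) _.
- by move=> G _ /disj_trail_witness.
- move=> F _ _ cF.
  (* Starting from all endpoints of [F] and [e] absorbs the edges which are forced to be open: a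
     closed set containing [B] stays closed when they are added. *)
  pose B := [set x.1 | x in F] :|: [set x.2 | x in F] :|: [set e.1; e.2].
  have cB : (#|B| <= 4 * h + 2)%N.
    have c1 : (#|[set x.1 | x in F]| <= #|F|)%N := leq_imset_card _ _.
    have c2 : (#|[set x.2 | x in F]| <= #|F|)%N := leq_imset_card _ _.
    have c3 : (#|[set e.1; e.2]| <= 2)%N by rewrite cards2; case: (_ == _).
    apply: leq_trans (leq_card_setU _ _) _; apply: leq_add c3.
    apply: leq_trans (leq_card_setU _ _) _.
    by apply: leq_trans (leq_add c1 c2) _; move: cF; lia.
  apply: le_trans (_ : bprob p (all_edges :\ e :\: F)
      (fun G => ~~ small s B G) <= _).
    apply: le_bprob => // G _; apply: contra => /smallP[S [BS clS ltS]].
    have eS : e.2 \in S by apply: (subsetP BS); rewrite !inE eqxx !orbT.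
    apply/smallP; exists S; split => //; first by rewrite sub1set.
    move=> a u aS uS; rewrite !inE !negb_or; apply/and3P; split; last exact: clS.
      by apply: contra uS => /eqP ee; rewrite -ee in eS.
    apply: contra uS => auF; apply: (subsetP BS); rewrite !inE.
    by apply/orP; left; apply/orP; right; apply/imsetP; exists (a, u).
  apply: le_trans (bprob_not_tiny p01 _ _ th1_0 _) _.
    by rewrite -setI_eq0 setICr.
  rewrite ler_expR cardsC; apply: lerD => //.
  by apply: ler_wpM2l => //; rewrite lerB // ler_nat.
by rewrite mulrC; apply: ler_wpM2r => //; exact: bprob_disj_trail.
Qed.

(** A small reach is a decreasing event, so here Harris' inequality separates it from the two
    trails, and the open edges of [t] only make it less likely. *)
Lemma bprob_narrow_trail v t : size t = K ->
  bprob p all_edges (narrow_trail h s v t) <=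
  p ^+ K * b ^+ 2 * expR (- (th2 * #|[set x in v :: t]|%:R) + ka * s%:R).
Proof.
case/andP: (p01) => p0 p1 tK; set B := [set x in v :: t].
set D := expR _; have D0 : 0 <= D by exact: expR_ge0.
have [tE|tE] := boolP (saop all_edges v t); last first.
  apply: (@le_trans _ _ 0); last by rewrite !mulr_ge0 ?exprn_ge0.
  rewrite -(bexp_cst p all_edges 0); apply: le_bexp => // G.
  rewrite powersetE /narrow_trail => GE; case: (boolP (saop G v t)) => //=.
  case/andP => /allP tG tU; move: tE; rewrite /saop tU andbT => /negP[].
  by apply/allP => x /tG; exact: subsetP.
case/andP: tE => /allP tE tU; set F := trail_edges v t.
have FE : F \subset all_edges by apply/subsetP => x; rewrite inE => /tE.
have cF : #|F| = K.
  rewrite cardsE (card_uniqP tU) size_zip /= tK minnE; lia.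
pose A := disj (trail false h v) (trail true h (last v t)).
apply: le_trans (@bprob_subset _ F _ (fun G => A (G :\: F) && small s B G) _ FE) _.
  move=> G _ /and3P[/andP[/allP tG _] AG sG]; split; last exact/andP.
  by apply/subsetP => x; rewrite inE => /tG.
rewrite cF -mulrA; apply: ler_wpM2l; first by rewrite exprn_ge0.
have -> : bprob p (all_edges :\: F)
     (fun G => A ((F :|: G) :\: F) && small s B (F :|: G)) =
   bexp p (all_edges :\: F) (fun G => (A G)%:R * (small s B (F :|: G))%:R).
  apply: eq_bexp => G; rewrite powersetE => GE.
  by rewrite (setU_setDK GE) -natrM mulnb.
have Ai : increasing (fun G => (A G)%:R : R).
  by apply: incrbP; apply: disj_incr; exact: trail_incr.
have Si : increasing (fun G => - (small s B (F :|: G))%:R : R).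
  move=> G H GH; rewrite lerN2; have := @small_decr _ s B _ _ (setUS F GH).
  by case: (small s B (F :|: H)) => [->|_] //; case: (small _ _ _).
apply: le_trans (harris_dec p01 _ Ai Si) _.
apply: ler_pM; rewrite ?bexp_ge0 //; first exact: bprob_disj_trail.
apply: le_trans (_ : bprob p (all_edges :\: F) (small s B) <= _).
  by apply: le_bprob => // G _; apply: small_decr; exact: subsetUr.
apply: (bprob_tiny p01 th2_0 ka0 kaq).
- by rewrite -setI_eq0 setICr.
- by rewrite cardsC.
(* An edge into a vertex off the trail is not an edge of the trail, so it is still unrevealed. *)
- move=> a u _; rewrite !inE negb_or => /andP[uv ut] au; rewrite au andbT.
  apply: contra ut => /(map_f snd); rewrite -/(unzip2 _) unzip2_zip //=.
Qed.

Lemma sum_narrow_trail :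
  \sum_(vt : V * K.-tuple V) bprob p all_edges (narrow_trail h s vt.1 vt.2) <=
  p ^+ K * b ^+ 2 * expR (ka * s%:R) *
    (#|V|%:R * (#|V|%:R * expR (- th2) + K%:R) ^+ K).
Proof.
case/andP: (p01) => p0 p1.
apply: le_trans (_ : \sum_(vt : V * K.-tuple V) p ^+ K * b ^+ 2 *
   expR (ka * s%:R) * expR (- th2) ^+ #|[set vt.1] :|: [set x in vt.2]| <= _).
  apply: ler_sum => -[v t] _ /=.
  apply: le_trans (bprob_narrow_trail _ (size_tuple t)) _.
  rewrite -[leRHS]mulrA -expRM_natr -expRD; apply: ler_wpM2l.
    by rewrite mulr_ge0 ?exprn_ge0.
  rewrite ler_expR addrC mulNr (_ : [set vt in v :: t] = [set v] :|: [set x in t]) //.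
  by apply/setP => x; rewrite !inE.
rewrite -mulr_sumr; apply: ler_wpM2l.
  by rewrite !mulr_ge0 ?exprn_ge0 ?expR_ge0.
rewrite -(pair_bigA _ (fun v (t : K.-tuple V) =>
  expR (- th2) ^+ #|[set v] :|: [set x in t]|)) /=.
have z1 : expR (- th2) <= 1 by rewrite -expR0 ler_expR oppr_le0.
apply: le_trans (_ : \sum_(v : V) (#|V|%:R * expR (- th2) + K%:R) ^+ K <= _).
  apply: ler_sum => v _.
  apply: le_trans (sum_exprn_card (N := K) (expR_ge0 _) _) _; first by rewrite cards1.
  rewrite cards1 expr1 ler_piMl // exprn_ge0 // addr_ge0 ?mulr_ge0 ?expR_ge0 //.
by rewrite sumr_const -[leLHS]mulr_natl.
Qed.

(** Each alternative of [is_trail_wide_or_narrow] provides [h] objects, so Markov's inequality gains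
    a factor [h] over the union bound. *)
Lemma bprob_longest : (0 < K)%N ->
  h%:R * bprob p all_edges (fun G => K + 4 * h <= longest_saop G)%N <=
  b ^+ 2 * (#|V|%:R ^+ 2 * p * wide_bound +
    p ^+ K * #|V|%:R * (#|V|%:R * expR (- th2) + K%:R) ^+ K * expR (ka * s%:R)).
Proof.
move=> K0.
pose A G := (h <= #|[set e | wide_edge h s e G]|)%N.
pose B G := (h <= #|[set vt : V * K.-tuple V | narrow_trail h s vt.1 vt.2 G]|)%N.
have AB : bprob p all_edges (fun G => K + 4 * h <= longest_saop G)%N <=
    bprob p all_edges A + bprob p all_edges B.
  rewrite -bexpD; apply: le_bexp => // G _.
  have : (K + 4 * h <= longest_saop G)%N -> A G \/ B G.
    move=> KL; have [|w wM] := @longest_trail V (K + 4 * h) G; first by rewrite KL; lia.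
    exact: is_trail_wide_or_narrow wM.
  by case: (_ <= _)%N => [/(_ isT)[]->|_]; rewrite ?addr_ge0 ?lerDl ?lerDr.
apply: le_trans (ler_wpM2l (ler0n _ h) AB) _; rewrite mulrDr mulrDr.
apply: lerD.
  apply: le_trans (_ : \sum_(e : V * V) p * b ^+ 2 * wide_bound <= _).
    apply: le_trans (@bprob_markov _ _ _ p01 _ _ _ (wide_edge h s) h _) _ => //.
    by apply: ler_sum => e _; exact: bprob_wide_edge.
  rewrite sumr_const card_prod -[leLHS]mulr_natl natrM.
  by rewrite le_eqVlt; apply/orP; left; apply/eqP; ring.
apply: le_trans (@bprob_markov _ _ _ p01 _ _ B
  (fun vt : V * K.-tuple V => narrow_trail h s vt.1 vt.2) h _) _ => //.
apply: le_trans sum_narrow_trail _.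
by rewrite le_eqVlt; apply/orP; left; apply/eqP; ring.
Qed.


End Bounds.
End FirstMoment.

(** * The critical window *)

Section ExponentialBounds.
Variable R : realType.
Implicit Types th w t y La : R.

Lemma expRN_le_quadratic th : 0 <= th -> expR (- th) <= 1 - th + th ^+ 2.
Proof.
move=> th0; rewrite expRN -[leLHS]mul1r ler_pdivrMr ?expR_gt0 //.
have e1 : 1 + th <= expR th by exact: expR_ge1Dx.
have q0 : 0 <= 1 - th + th ^+ 2 by nra.
apply: le_trans (ler_wpM2l q0 e1).
have : 0 <= th ^+ 3 by rewrite exprn_ge0.
nra.
Qed.

Lemma expR_le_quadratic th : 0 <= th <= 1 / 2 -> expR th <= 1 + th + 2 * th ^+ 2.
Proof.
case/andP => th0 th1; rewrite -[th in leLHS]opprK expRN -[leLHS]mul1r.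
rewrite ler_pdivrMr ?expR_gt0 //.
have e1 : 1 - th <= expR (- th) by exact: expR_ge1Dx.
have q0 : 0 <= 1 + th + 2 * th ^+ 2 by nra.
apply: le_trans (ler_wpM2l q0 e1).
have : 0 <= th ^+ 2 * (1 - 2 * th) by rewrite mulr_ge0 ?sqr_ge0 // subr_ge0; lra.
nra.
Qed.

Lemma sum_sub_ord (n s : nat) : (s <= n)%N ->
  \sum_(i < s) (n - i.+1)%:R <= n%:R * s%:R - s%:R ^+ 2 / 2 :> R.
Proof.
move=> sn; suff -> : \sum_(i < s) (n - i.+1)%:R =
    n%:R * s%:R - s%:R * (s%:R + 1) / 2 :> R.
  by have : 0 <= s%:R :> R by []; nra.
elim: s sn => [|s IH] sn; first by rewrite big_ord0; lra.
rewrite big_ord_recr /= IH ?natrB //; last exact: ltnW.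
by rewrite -[s.+1%:R]natr1; lra.
Qed.

(** The exponent of the narrow case with [n = t^3], [K = w^2 t], [s = y t^2] and [th2 = w / t]. The
    leading term [- w ^+ 3] is [- th2 * K]; all others are smaller by constant factors. *)
Lemma narrow_exponent La w t y : 1 <= La -> 480 * La <= w -> 10 * w <= t ->
    0 <= y <= w / 6 ->
  - w ^+ 3 + 2 * (w ^+ 4 / t) + w ^+ 2 * La + (w * La * y + w * y ^+ 2 + w ^+ 2 * y)
    <= - ((w / 12) ^+ 3 / 100).
Proof.
move=> La1 Law wt /andP[y0 yw].
have w0 : 0 < w by lra.
have t0 : 0 < t by lra.
have h1 : w ^+ 4 / t <= w ^+ 3 / 10.
  rewrite ler_pdivrMr // exprSr -[leRHS]mulrA.
  by apply: ler_wpM2l; [rewrite exprn_ge0 ?ltW | lra].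
have w2 : 0 <= w ^+ 2 by rewrite sqr_ge0.
have h2 : w ^+ 2 * La <= w ^+ 3 / 480.
  by rewrite [w ^+ 3]exprSr -mulrA ler_wpM2l //; lra.
have h3 : w * La * y <= w * La * (w / 6).
  by rewrite ler_wpM2l // mulr_ge0 //; lra.
have h4 : w * y ^+ 2 <= w * (w / 6) ^+ 2.
  by apply: ler_wpM2l; [exact: ltW | rewrite lerXn2r ?nnegrE //; lra].
have h5 : w ^+ 2 * y <= w ^+ 2 * (w / 6) by rewrite ler_wpM2l.
have w3 : 0 <= w ^+ 3 by rewrite exprn_ge0 // ltW.
have e3 : w * La * (w / 6) = w ^+ 2 * La / 6 by field.
have e4 : w * (w / 6) ^+ 2 = w ^+ 3 / 36 by field.
have e5 : w ^+ 2 * (w / 6) = w ^+ 3 / 6 by field.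
have e6 : (w / 12) ^+ 3 / 100 <= w ^+ 3 / 100.
  rewrite ler_wpM2r // lerXn2r ?nnegrE //; lra.
rewrite e3 in h3; rewrite e4 in h4; rewrite e5 in h5.
lra.
Qed.

(** The exponent of the wide case with [th1 = y / (20 t)] and [z = (4 h + 2) / t]. The 20 keeps the
    second-order cost [y ^+ 3 / 100] below the gain from the drift. *)
Lemma wide_exponent La w y z : 1 <= La -> 480 * La <= w ->
    w / 12 <= y -> z <= 10 ->
  y / 20 * (z - y ^+ 2 / 2 + La * y) + 4 * (y / 20) ^+ 2 * y
    <= - ((w / 12) ^+ 3 / 100).
Proof.
move=> La1 Law yw z10.
have y40 : 40 * La <= y by lra.
have w0 : 0 <= w / 12 by lra.
have w3 : (w / 12) ^+ 3 <= y ^+ 3 by rewrite lerXn2r ?nnegrE //; lra.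
have y2 : 1600 <= y ^+ 2 by nra.
have h2 : La * y <= y ^+ 2 / 40.
  by rewrite expr2 mulrAC; apply: ler_wpM2r; lra.
have hb : z - y ^+ 2 / 2 + La * y <= - (4 / 10 * y ^+ 2) by lra.
have h4 : y / 20 * (z - y ^+ 2 / 2 + La * y) <= y / 20 * (- (4 / 10 * y ^+ 2)).
  by apply: ler_wpM2l; lra.
have e4 : y / 20 * (- (4 / 10 * y ^+ 2)) = - (y ^+ 3 / 50) by field.
have e5 : 4 * (y / 20) ^+ 2 * y = y ^+ 3 / 100 by field.
rewrite e4 in h4; rewrite e5; lra.
Qed.

(** * Choice of the parameters in units of [t = n^(1/3)] *)

Section MidRange.
Variables (V : finType) (p La t w : R) (h K : nat).
Let n := #|V|.
Hypotheses (La1 : 1 <= La) (tn : t ^+ 3 = n%:R) (Law : 480 * La <= w)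
  (wt : 10 * w <= t) (wK : w ^+ 2 * t = K%:R) (th : t <= h%:R <= t + 1)
  (p01 : 0 <= p <= 1) (np_lo : 1 - La / t <= n%:R * p)
  (np_hi : n%:R * p <= 1 + La / t).

Let w480 : 480 <= w. Proof. by move: La1 Law; lra. Qed.
Let t1 : 1000 <= t. Proof. by move: wt w480; lra. Qed.
Let t0 : 0 < t. Proof. by move: t1; lra. Qed.
Let n0 : 0 < n%:R :> R. Proof. by rewrite -tn exprn_gt0. Qed.
Let mu := 1 + La / t.
Let mu1 : 1 <= mu. Proof. by rewrite lerDl divr_ge0 ?ltW //; move: La1; lra. Qed.
Let mu2 : mu <= 2.
Proof.
by rewrite /mu -lerBrDl ler_pdivrMr //; move: wt Law w480; lra.
Qed.
(** From [bprob_trail_decay]: [mu ^+ h] is at most [expR (2 * La)] because [h <= 2 * t]. *)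
Let b := 4 * expR (2 * La) / t.

Let n2 : 2 <= n%:R :> R.
Proof. by rewrite -tn; have := t1; rewrite exprS expr2; nra. Qed.

Let p2 : p <= 1 / 2.
Proof.
have : n%:R * p <= 2 by apply: le_trans np_hi mu2.
have : 4 <= n%:R :> R by rewrite -tn; have := t1; rewrite exprS expr2; nra.
by case/andP: p01 => *; nra.
Qed.

Let trail_b (E : {set V * V}) d v : bprob p E (trail d h v) <= b.
Proof.
have h0 : 0 < h%:R :> R by case/andP: th => *; move: t0; lra.
have [m nm] : exists m, n = m.+1.
  by exists n.-1; rewrite prednK // -(ltr0n R).
have m0 : (0 < m)%N by rewrite -ltnS -nm -(ler_nat R).
have Em : n%:R = m.+1%:R :> R by rewrite nm.
have := @bprob_trail_decay R V p mu m h d m0 _ p01 _ _ E v.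
rewrite -/n nm leqnn -Em mu1 (le_trans mu2 n2) => /(_ isT isT).
rewrite ler_pdivlMr // mulrC => /(_ np_hi) kb.
have muh : mu ^+ h <= expR (2 * La).
  apply: le_trans (_ : expR (La / t) ^+ h <= _).
    by rewrite lerXn2r ?nnegrE ?expR_ge0 ?expR_ge1Dx // (le_trans _ mu1).
  rewrite -expRM_natr ler_expR mulrAC ler_pdivrMr //.
  case/andP: th => _ ht; have : h%:R <= 2 * t by move: t1; lra.
  by move: La1; nra.
rewrite /b ler_pdivlMr //; apply: le_trans (_ : bprob p E (trail d h v) * h%:R <= _).
  by rewrite ler_wpM2l ?(bprob_ge0 p01) //; case/andP: th.
by rewrite mulrC; apply: le_trans kb _; rewrite ler_wpM2l.
Qed.

(** Rounding down at most halves the value, so the rescaled size [y] lies between [w / 12] and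
    [w / 6]. *)
Let s := Num.truncn (w * t ^+ 2 / 6).
Let y : R := s%:R / t ^+ 2.

Let y_bounds : w / 12 <= y <= w / 6.
Proof.
have wt2 : 12 <= w * t ^+ 2 by have := w480; have := t1; rewrite expr2; nra.
have t20 : 0 < t ^+ 2 by rewrite exprn_gt0.
have wt0 : 0 <= w * t ^+ 2 / 6 by lra.
have /andP[s1 s2] := truncn_itv wt0; rewrite -/s in s1 s2.
rewrite -[s.+1%:R]natr1 in s2; rewrite /y ler_pdivlMr // ler_pdivrMr //.
by apply/andP; split; lra.
Qed.

Let sn : (s <= n)%N.
Proof.
rewrite -(ler_nat R) -tn; case/andP: y_bounds => _; rewrite /y ler_pdivrMr ?exprn_gt0 //.
move=> h1; apply: le_trans h1 _; rewrite [t ^+ 3]exprS ler_wpM2r ?exprn_ge0 ?ltW //.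
by move: wt w480; lra.
Qed.

Let sy : s%:R = y * t ^+ 2. Proof. by rewrite /y divfK // lt0r_neq0 // exprn_gt0. Qed.

Lemma wide_bound_le :
  wide_bound V p h s (y / 20 / t) <= expR (- ((w / 12) ^+ 3 / 100)).
Proof.
rewrite ler_expR; set th1 := y / 20 / t.
case/andP: (p01) => p0 p1; case/andP: (y_bounds) => y1 y2.
have th0 : 0 <= th1.
  by rewrite divr_ge0 ?(ltW t0) // divr_ge0 //; move: w480; lra.
have th12 : th1 <= 1 / 2 by rewrite ler_pdivrMr //; move: wt w480; lra.
have e1 : expR th1 - 1 <= th1 + 2 * th1 ^+ 2.
  by have := @expR_le_quadratic th1; rewrite th0 th12 => /(_ isT); lra.
have e0 : 0 <= expR th1 - 1 by rewrite subr_ge0 -expR0 ler_expR.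
set S := \sum_(i < s) _.
have s0 : 0 <= s%:R :> R by [].
(* The saving [s ^ 2 / (2 n)] comes from the depletion of unexplored vertices; it has to beat the
   excess [La * s / t] allowed by the critical window. *)
have pS : p * S <= s%:R - s%:R ^+ 2 / (2 * n%:R) + La / t * s%:R.
  apply: le_trans (ler_wpM2l p0 (sum_sub_ord sn)) _.
  have -> : p * (n%:R * s%:R - s%:R ^+ 2 / 2) =
      (n%:R * p) * (s%:R - s%:R ^+ 2 / (2 * n%:R)) by field; exact: lt0r_neq0.
  have d0 : 0 <= s%:R ^+ 2 / (2 * n%:R) :> R by rewrite divr_ge0 ?sqr_ge0 // mulr_ge0.
  have d1 : 0 <= s%:R - s%:R ^+ 2 / (2 * n%:R) :> R.
    rewrite subr_ge0 ler_pdivrMr ?mulr_gt0 // expr2 ler_wpM2l //.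
    by apply: le_trans (_ : n%:R <= _); [rewrite ler_nat | rewrite ler_peMl ?ler0n // ler1n].
  apply: le_trans (ler_wpM2r d1 np_hi) _.
  have : 0 <= La / t * (s%:R ^+ 2 / (2 * n%:R)).
    by rewrite mulr_ge0 // divr_ge0 ?ltW //; move: La1; lra.
  by rewrite mulrDl mul1r mulrBr; lra.
set m := s%:R - _ + _ in pS.
have m0 : 0 <= m by apply: le_trans pS; rewrite mulr_ge0 // sumr_ge0.
have m2 : m <= 2 * s%:R.
  have d0 : 0 <= s%:R ^+ 2 / (2 * n%:R) :> R by rewrite divr_ge0 ?sqr_ge0 // mulr_ge0.
  have : La / t * s%:R <= 1 * s%:R.
    by rewrite ler_wpM2r // ler_pdivrMr // mul1r; move: wt Law w480; lra.
  rewrite /m; lra.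
have ePS : (expR th1 - 1) * p * S <= th1 * m + 4 * th1 ^+ 2 * s%:R.
  rewrite -mulrA; apply: le_trans (ler_wpM2l e0 pS) _.
  apply: le_trans (ler_wpM2r m0 e1) _.
  have : 2 * th1 ^+ 2 * m <= 2 * th1 ^+ 2 * (2 * s%:R).
    by rewrite ler_wpM2l // mulr_ge0 // sqr_ge0.
  lra.
apply: le_trans (lerD (lexx _) ePS) _.
have := @wide_exponent La w y ((4 * h + 2)%:R / t) La1 Law y1.
have -> : (4 * h + 2)%:R / t <= 10.
  rewrite ler_pdivrMr // natrD natrM; case/andP: th => _; move: t1; lra.
move=> /(_ isT); apply: le_trans; rewrite le_eqVlt; apply/orP; left; apply/eqP.
rewrite /m /th1 -tn sy; field; exact: lt0r_neq0.
Qed.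

Let th2 := w / t.
(** Bounds how far the mean offspring [p * (n - s)] can fall below 1. *)
Let de := La / t + s%:R / n%:R.
Let ka := th2 * de + th2 ^+ 2.

Let th2_0 : 0 <= th2. Proof. by rewrite divr_ge0 ?ltW //; move: w480; lra. Qed.
Let de0 : 0 <= de. Proof. by rewrite addr_ge0 // divr_ge0 ?ltW //; move: La1; lra. Qed.
Let ka0 : 0 <= ka. Proof. by rewrite addr_ge0 ?sqr_ge0 // mulr_ge0. Qed.

Let kaq : th2 - p * (n - s)%:R * (1 - expR (- th2)) <= ka.
Proof.
have e1 := expRN_le_quadratic th2_0.
have e2 : 1 - expR (- th2) <= th2 by have := expR_ge1Dx (- th2); lra.
have e0 : 0 <= 1 - expR (- th2) by rewrite subr_ge0 -expR0 ler_expR oppr_le0.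
have pq : 1 - de <= p * (n - s)%:R.
  have -> : p * (n - s)%:R = (n%:R * p) * (1 - s%:R / n%:R).
    by rewrite natrB //; field; exact: lt0r_neq0.
  have sn1 : 0 <= 1 - s%:R / n%:R :> R.
    by rewrite subr_ge0 ler_pdivrMr // mul1r ler_nat.
  apply: le_trans (ler_wpM2r sn1 np_lo); rewrite /de.
  have : 0 <= La / t * (s%:R / n%:R).
    by rewrite mulr_ge0 // divr_ge0 ?ltW //; move: La1; lra.
  lra.
have := ler_wpM2r e0 pq; have := ler_wpM2l de0 e2; rewrite /ka; lra.
Qed.

Lemma narrow_bound_le :
  (n%:R * p) ^+ K * (expR (- th2) + K%:R / n%:R) ^+ K * expR (ka * s%:R) <=
  expR (- ((w / 12) ^+ 3 / 100)).
Proof.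
case/andP: (p01) => p0 p1; case/andP: (y_bounds) => y1 y2.
have h1 : (n%:R * p) ^+ K <= expR (La / t * K%:R).
  rewrite expRM_natr; apply: lerXn2r; rewrite ?nnegrE ?expR_ge0 ?mulr_ge0 //.
  exact: le_trans np_hi (expR_ge1Dx _).
have h2 : (expR (- th2) + K%:R / n%:R) ^+ K <=
    expR ((- th2 + th2 ^+ 2 + K%:R / n%:R) * K%:R).
  rewrite expRM_natr; apply: lerXn2r; rewrite ?nnegrE ?expR_ge0 //.
  apply: le_trans (expR_ge1Dx _).
  by have := expRN_le_quadratic th2_0; lra.
apply: le_trans (_ : expR (La / t * K%:R) *
  expR ((- th2 + th2 ^+ 2 + K%:R / n%:R) * K%:R) * expR (ka * s%:R) <= _).
  rewrite ler_wpM2r ?expR_ge0 //; apply: ler_pM => //.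
  by rewrite exprn_ge0 // mulr_ge0.
rewrite -!expRD ler_expR.
have := @narrow_exponent La w t y La1 Law wt.
rewrite y2 (le_trans _ y1) ?divr_ge0 //; last by move: w480; lra.
move=> /(_ isT); apply: le_trans; rewrite le_eqVlt; apply/orP; left; apply/eqP.
rewrite /ka /de /th2 -tn -wK sy; field; exact: lt0r_neq0.
Qed.

Lemma bprob_longest_midrange :
  bprob p (all_edges V) (fun G => K + 4 * h <= longest_saop G)%N <=
  48 * expR (4 * La) * expR (- ((w / 12) ^+ 3 / 100)).
Proof.
case/andP: (p01) => p0 p1.
have K0 : (0 < K)%N.
  by rewrite -(ltr0n R) -wK mulr_gt0 // exprn_gt0 //; move: w480; lra.
have b0 : 0 <= b by apply: divr_ge0 (ltW t0); apply: mulr_ge0; rewrite ?expR_ge0.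
have th1_0 : 0 <= y / 20 / t.
  by case/andP: y_bounds => *; rewrite divr_ge0 ?(ltW t0) // divr_ge0 //; move: w480; lra.
have qs : ((n - s) + s <= #|V|)%N by rewrite subnK.
have := bprob_longest p01 p2 b0 trail_b th1_0 th2_0 ka0 kaq qs K0.
set P := bprob _ _ _; set D := expR (- ((w / 12) ^+ 3 / 100)) => HP.
have D0 : 0 <= D by exact: expR_ge0.
have h0 : 0 < h%:R :> R by case/andP: th => *; move: t0; lra.
have W : #|V|%:R ^+ 2 * p * wide_bound V p h s (y / 20 / t) <= 2 * n%:R * D.
  apply: ler_pM; rewrite ?mulr_ge0 ?sqr_ge0 ?expR_ge0 //; last exact: wide_bound_le.
  rewrite -/n expr2 -mulrA mulrC; apply: ler_wpM2r => //.
  exact: le_trans np_hi mu2.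
have N : p ^+ K * #|V|%:R * (#|V|%:R * expR (- th2) + K%:R) ^+ K * expR (ka * s%:R)
    <= n%:R * D.
  have -> : p ^+ K * #|V|%:R * (#|V|%:R * expR (- th2) + K%:R) ^+ K * expR (ka * s%:R)
     = n%:R * ((n%:R * p) ^+ K * (expR (- th2) + K%:R / n%:R) ^+ K * expR (ka * s%:R)).
    rewrite -/n (_ : n%:R * expR (- th2) + K%:R = n%:R * (expR (- th2) + K%:R / n%:R)).
      by rewrite !exprMn; ring.
    by field; exact: lt0r_neq0.
  by rewrite ler_wpM2l // narrow_bound_le.
(* The 3 is 2 from the wide edges, as [n * p <= 2], plus 1 from the narrow trails. With the 16 in
   [b ^+ 2] it gives the constant 48. *)
have {}HP : h%:R * P <= b ^+ 2 * (3 * n%:R * D).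
  apply: le_trans HP _; rewrite ler_wpM2l ?sqr_ge0 //.
  by move: W N; set x := wide_bound _ _ _ _ _; lra.
have {}HP : t * P <= b ^+ 2 * (3 * n%:R * D).
  apply: le_trans HP; apply: ler_wpM2r; first exact: bprob_ge0.
  by case/andP: th.
have E4 : expR (4 * La) = expR (2 * La) ^+ 2.
  by rewrite -expRM_natr; congr expR; ring.
rewrite -(ler_pM2l t0); apply: le_trans HP _; rewrite le_eqVlt; apply/orP; left.
apply/eqP; rewrite /b -tn E4; field; exact: lt0r_neq0.
Qed.

End MidRange.
End ExponentialBounds.

(** * Tail bounds *)

Section Tails.
Variable R : realType.
Implicit Types (p x t La : R).

Lemma longest_saop_le (V : finType) (G : {set V * V}) :
  (longest_saop G <= #|G|)%N.
Proof. by apply/bigmax_leqP => k _; rewrite -ltnS ltn_ord. Qed.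

Lemma diam_le_longest (V : finType) (G : {set V * V}) :
  (diam R G <= (longest_saop G)%:R%:E)%E.
Proof.
apply: bigmax_le => [|i _]; first exact: leNye.
apply: bigmax_le => [|j _]; first exact: leNye.
rewrite /ddist; case: pselect => [ex_k|_]; last exact: leNye.
case: ex_minnP => m ijm _; rewrite lee_fin ler_nat.
have mG : (m < #|G|.+1)%N.
  case/existsP: ijm => s /andP[/saop_size]; by rewrite size_tuple ltnS.
apply: (leq_bigmax_cond (Ordinal mG)) => /=.
by apply/existsP; exists i; apply/existsP; exists j.
Qed.

Lemma Gnp_prE n p (A : pred {set 'I_n * 'I_n}) :
  Gnp_pr p A = bprob p (all_edges 'I_n) A.
Proof.
rewrite /Gnp_pr /bprob /bexp big_mkcondr; apply: eq_bigr => G _.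
by case: (A G); rewrite ?mulr1 ?mulr0.
Qed.

(** Chernoff's bound with parameter 1/2, where [expR (1 / 2) <= 2]. *)
Lemma bprob_card_gt (T : finType) p (E : {set T}) (m : R) : 0 <= p <= 1 ->
  bprob p E (fun G => m < #|G|%:R) <= expR (p * #|E|%:R - m / 2).
Proof.
move=> p01; case/andP: (p01) => p0 p1.
apply: le_trans (_ : bexp p E (fun G => expR (- (m / 2)) * expR (1 / 2) ^+ #|G|) <= _).
  apply: le_bexp => // G _; rewrite -expRM_natr -expRD.
  case: ltP => [mG|_]; last exact: expR_ge0.
  by apply: le_trans (expR_ge1Dx _); rewrite /=; lra.
rewrite bexpZ bexp_exprn addrC expRD mulrC.
apply: ler_wpM2r; first exact: expR_ge0.
rewrite expRM_natr; apply: lerXn2r; rewrite ?nnegrE ?expR_ge0 //.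
  by have := mulr_ge0 p0 (expR_ge0 (1 / 2 : R)); lra.
apply: le_trans (expR_ge1Dx _).
have := @expR_le_quadratic R (1 / 2); rewrite lexx divr_ge0 // => /(_ isT) e2.
have {}e2 : expR (1 / 2) <= 2 :> R by apply: le_trans e2 _; lra.
by have := ler_wpM2l p0 e2; lra.
Qed.

(** For [w] of order [sqrt x], a decay in [w ^+ 3] is thus stronger than the required [x * ln x]. *)
Lemma x_ln_le x : 1 <= x -> x * ln x <= 2 * Num.sqrt x ^+ 3.
Proof.
move=> x1; have x0 : 0 <= x by lra.
set v := Num.sqrt x; have v2 : x = v ^+ 2 by rewrite sqr_sqrtr.
have v0 : 0 < v by rewrite sqrtr_gt0; lra.
rewrite {1 2}v2 lnXn // -mulr_natl.
have : ln v <= v by apply: le_trans (ltW (ln_sublinear v0)) _.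
move=> lv; have := ler_wpM2l (sqr_ge0 v) lv; lra.
Qed.

Lemma cube_root n : (1 <= n)%N -> let t := n%:R `^ (1 / 3) : R in
  [/\ 1 <= t, t ^+ 3 = n%:R & n%:R `^ (- (4 / 3)) = (t ^+ 4)^-1].
Proof.
move=> n1 t; have n1R : 1 <= n%:R :> R by rewrite ler1n.
have n0 : n%:R != 0 :> R by rewrite pnatr_eq0 -lt0n.
split.
- have h : 0 <= 1 / 3 :> R by lra.
  by have := ler_powR n1R h; rewrite powRr0.
- rewrite /t -powR_mulrn ?powR_ge0 // -powRrM (_ : 1 / 3 * 3%:R = 1) ?powRr1 //.
  by field.
- rewrite powRN /t -powR_mulrn ?powR_ge0 // -powRrM.
  by congr (_ `^ _)^-1; field.
Qed.

(** Half of [c1 * sqrt x ^+ 3] absorbs [D], the other half dominates the right-hand side by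
    [x_ln_le]. *)
Lemma absorb_constant (c1 D x : R) : 0 < c1 -> 0 <= D -> 1 <= x ->
    (2 * D / c1) ^+ 2 <= x ->
  D - c1 * Num.sqrt x ^+ 3 <= - (c1 / 4 * x * ln x).
Proof.
move=> c0 D0 x1 Dx; have := x_ln_le x1; set v := Num.sqrt x => xv.
have x0 : 0 <= x by lra.
have vN : v \is Num.nneg by rewrite nnegrE sqrtr_ge0.
have v1 : 1 <= v by rewrite -[leLHS]sqrtr1 ler_wsqrtr.
have Dv : 2 * D / c1 <= v.
  have DN : 2 * D / c1 \is Num.nneg.
    by rewrite nnegrE; apply: divr_ge0 (ltW c0); apply: mulr_ge0.
  by rewrite -(ler_sqr DN vN) sqr_sqrtr.
rewrite ler_pdivrMr // in Dv.
have v3 : v <= v ^+ 3 by rewrite exprS ler_peMr ?exprn_ege1 //; lra.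
have := ler_wpM2l (ltW c0) xv; have := ler_wpM2l (ltW c0) v3.
lra.
Qed.

(** * Large and moderate values of [x] *)

Section Regimes.
Variables (La : R) (n : nat) (p t : R).
Hypotheses (La1 : 1 <= La) (t1 : 1 <= t) (tn : t ^+ 3 = n%:R)
  (p01 : 0 <= p <= 1) (np : `|n%:R * p - 1| <= La / t).
Let P x := bprob p (all_edges 'I_n) (fun G => x * t < (longest_saop G)%:R).

(** Here [x * t] exceeds [16 * La * n], while at most [2 * La * n] edges are expected, so it is
    enough to count edges. *)
Lemma tail_dense c x : 0 < c <= 1 / 24 -> 0 < x -> 16 * La * t ^+ 2 < x ->
  P x <= expR (- (c * x * ln x)).
Proof.
move=> /andP[c0 c1] x0 Bx; have t0 : 0 < t by apply: lt_le_trans t1.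
(* [t ^+ 6] is the square of [n], so for larger [x] there are not enough edges; otherwise
   [ln x <= 6 * t]. *)
have [xt|tx] := leP (t ^+ 6) x.
  apply: le_trans (expR_ge0 _).
  rewrite -(bexp_cst p (all_edges 'I_n) 0); apply: le_bexp => // G _.
  suff : (longest_saop G)%:R <= x * t by case: ltP.
  apply: le_trans (_ : x <= _); last by rewrite ler_peMr // ltW.
  apply: le_trans xt; rewrite (_ : t ^+ 6 = (t ^+ 3) ^+ 2); last by rewrite -exprM.
  rewrite tn -natrX ler_nat.
  apply: leq_trans (longest_saop_le _) _; apply: leq_trans (max_card _) _.
  by rewrite card_prod card_ord expnS expn1.
apply: le_trans (_ : bprob p (all_edges 'I_n) (fun G => x * t < #|G|%:R) <= _).
  apply: le_bprob => // G _ /lt_le_trans; apply; rewrite ler_nat.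
  exact: longest_saop_le.
apply: le_trans (bprob_card_gt _ _ p01) _; rewrite ler_expR.
case/andP: (p01) => p0 p1.
have lnx : ln x <= 6 * t.
  apply: le_trans (_ : ln (t ^+ 6) <= _); first by rewrite ler_ln ?posrE ?exprn_gt0 // ltW.
  rewrite lnXn // -[leLHS]mulr_natl; apply: ler_wpM2l => //.
  exact/ltW/ln_sublinear.
(* The bound 1/24 on [c] makes this a quarter of [x * t], while Chernoff's bound leaves three
   eighths. *)
have h1 : c * x * ln x <= 1 / 24 * x * (6 * t).
  apply: le_trans (_ : c * x * (6 * t) <= _).
    by rewrite ler_wpM2l // mulr_ge0 ?ltW.
  apply: ler_wpM2r; first by rewrite mulr_ge0 // ltW.
  by apply: ler_wpM2r => //; exact: ltW.
have cE : #|all_edges 'I_n|%:R <= n%:R ^+ 2 :> R.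
  by rewrite -natrX ler_nat (leq_trans (max_card _)) // card_prod card_ord expnS expn1.
have h2 : p * #|all_edges 'I_n|%:R <= 2 * La * t ^+ 3.
  apply: le_trans (ler_wpM2l p0 cE) _.
  have -> : p * n%:R ^+ 2 = (n%:R * p) * n%:R by ring.
  rewrite -tn; apply: ler_wpM2r; first by rewrite exprn_ge0 // ltW.
  have : La / t <= La by rewrite ler_pdivrMr // ler_peMr //; move: La1; lra.
  by rewrite tn; move: np La1; rewrite ler_norml => /andP[_ np1]; lra.
have h3 : 16 * La * t ^+ 3 <= x * t.
  by rewrite exprSr mulrA; apply: ler_wpM2r; exact: ltW.
have h4 : 0 <= x * t by rewrite mulr_ge0 // ltW.
apply: le_trans (lerB h2 (lexx _)) _; clear cE h2; lra.
Qed.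

Lemma tail_sparse B x : B = 16 * La -> x <= B * t ^+ 2 ->
    200 * B * (480 * La) ^+ 2 <= x ->
  P x <= 48 * expR (4 * La) *
    expR (- ((Num.sqrt x / (200 * B) / 12) ^+ 3 / 100)).
Proof.
move=> BE xB xLa.
have B16 : 16 <= B by rewrite BE; move: La1; lra.
have La2 : 1 <= La ^+ 2 by rewrite exprn_ege1.
have t0 : 0 < t by apply: lt_le_trans t1.
have La1' := La1; have t1' := t1.
(* As [x <= B * t ^+ 2], this gives [z <= t ^+ 2 / 100] and later [10 * w <= t]; it also leaves room
   for the [4 * h] extra edges. *)
pose z := x / (100 * B).
have B0 : 0 < 100 * B by lra.
have zx : x = z * (100 * B) by rewrite /z divfK // lt0r_neq0.
have z1 : 2 * (480 * La) ^+ 2 <= z by rewrite /z ler_pdivlMr //; lra.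
have z480 : 480 <= z by move: z1; rewrite exprMn; nra.
have zt2 : z <= t ^+ 2 / 100 by rewrite /z ler_pdivrMr //; move: xB; lra.
have zt0 : 0 <= z * t by rewrite mulr_ge0 //; lra.
pose K := Num.truncn (z * t).
have /andP[K1] := truncn_itv zt0; rewrite -/K in K1 *.
rewrite -[K.+1%:R]natr1 => K2.
have zt : z <= z * t by rewrite ler_peMr //; lra.
have K3 : z * t / 2 <= K%:R by lra.
(* Defined from the integer [K], so that [w ^+ 2 * t = K] holds exactly. *)
pose w := Num.sqrt (K%:R / t).
have w2 : w ^+ 2 = K%:R / t by rewrite sqr_sqrtr // divr_ge0 // ltW.
have w0 : 0 <= w by exact: sqrtr_ge0.
have wN : w \is Num.nneg by rewrite nnegrE.
have wz : w ^+ 2 <= z by rewrite w2 ler_pdivrMr.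
have zw : z / 2 <= w ^+ 2 by rewrite w2 ler_pdivlMr // mulrAC.
have Law : 480 * La <= w.
  have La0 : 480 * La \is Num.nneg by rewrite nnegrE; lra.
  by rewrite -(ler_sqr La0 wN); apply: le_trans zw; lra.
clear z1 xLa La2.
have wt : 10 * w <= t.
  have w10 : 10 * w \is Num.nneg by rewrite nnegrE; lra.
  have tN : t \is Num.nneg by rewrite nnegrE ltW.
  rewrite -(ler_sqr w10 tN) exprMn; lra.
have wK : w ^+ 2 * t = K%:R by rewrite w2 divfK // lt0r_neq0.
pose h := (Num.truncn t).+1.
have /andP[h1 h2] := truncn_itv (ltW t0).
have th : t <= h%:R <= t + 1.
  by rewrite (ltW h2) /h -natr1 lerD2r.
have := np; rewrite ler_norml => /andP[np1 np2].
have npl : 1 - La / t <= n%:R * p by lra.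
have npu : n%:R * p <= 1 + La / t by lra.
have := @bprob_longest_midrange R 'I_n p La t w h K La1.
rewrite card_ord => /(_ tn Law wt wK th p01 npl npu) HP.
apply: le_trans (_ : bprob p (all_edges 'I_n) (fun G => K + 4 * h <= longest_saop G)%N <= _).
  apply: le_bprob => // G _ xL; rewrite -(ler_nat R); apply: le_trans (ltW xL).
  rewrite natrD natrM; case/andP: th => _ th.
  have : z * t * 100 <= x * t.
    rewrite zx (_ : z * (100 * B) * t = z * t * 100 * B); last by ring.
    by apply: ler_peMr; lra.
  have : 480 * t <= z * t by rewrite ler_wpM2r // ltW.
  by lra.
apply: le_trans HP _; rewrite ler_wpM2l ?mulr_ge0 ?expR_ge0 // ler_expR lerN2.
pose v := Num.sqrt x / (200 * B).
have v0 : 0 <= v by rewrite divr_ge0 ?sqrtr_ge0 //; lra.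
have x0 : 0 <= x by rewrite zx mulr_ge0 //; lra.
have vw : v <= w.
  have vN : v \is Num.nneg by rewrite nnegrE.
  rewrite -(ler_sqr vN wN) exprMn sqr_sqrtr // exprVn.
  apply: le_trans zw; rewrite ler_pdivrMr; last by apply: exprn_gt0; lra.
  have -> : z / 2 * (200 * B) ^+ 2 = z * (100 * B) * (200 * B) by field.
  by rewrite -zx; apply: ler_peMr; lra.
apply: ler_wpM2r; first by rewrite invr_ge0.
have vN12 : v / 12 \is Num.nneg by rewrite nnegrE divr_ge0.
have wN12 : w / 12 \is Num.nneg by rewrite nnegrE divr_ge0.
by apply: lerXn2r vN12 wN12 _; rewrite ler_wpM2r // invr_ge0.
Qed.

End Regimes.
End Tails.

Local Open Scope classical_set_scope.

(** Turns the asymptotic hypothesis into a bound with one constant for all [n >= 1], since the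
    theorem is uniform in [n]. *)
Lemma critical_window (R : realType) (p : nat -> R) :
    (forall n : nat, (1 <= n)%N -> 0 <= p n <= 1) ->
    (fun n => p n - n%:R^-1) =O_\oo (fun n => n%:R `^ (- (4 / 3)) : R) ->
  exists2 La, 1 <= La & forall n : nat, (1 <= n)%N ->
    `|n%:R * p n - 1| <= La / n%:R `^ (1 / 3).
Proof.
move=> p01 /eqOP pO.
have [k [k1 [N _ HN]]] : exists k, 1 <= k /\ \forall n \near \oo,
    `|p n - n%:R^-1| <= k * `|n%:R `^ (- (4 / 3)) : R|.
  have [k0 [_ Hk]] := pO; exists (Num.max 1 (k0 + 1)); split.
    by rewrite le_max lexx.
  by apply: Hk; rewrite lt_max ltrDl ltr01 orbT.
(* The second term covers [n < N]: there the left side is at most [n], and [n * t <= N ^ 2] because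
   [t <= n]. *)
exists (k + N%:R ^+ 2); first by have := sqr_ge0 (N%:R : R); lra.
move=> n n1; set t := n%:R `^ (1 / 3).
have [t1 tn tn4] := cube_root R n1; rewrite -/t in t1 tn tn4.
have t0 : 0 < t by lra.
have n0 : 0 < n%:R :> R by rewrite ltr0n.
have -> : n%:R * p n - 1 = n%:R * (p n - n%:R^-1).
  by rewrite mulrBr divff // lt0r_neq0.
rewrite normrM gtr0_norm // mulrDl.
have [Nn|nN] := leqP N n.
  apply: le_trans (ler_wpM2l (ltW n0) (HN n Nn)) _.
  rewrite tn4 ger0_norm; last by rewrite invr_ge0 exprn_ge0 // ltW.
  rewrite -tn.
  rewrite (_ : t ^+ 3 * (k / t ^+ 4) = k / t); last by field; exact: lt0r_neq0.
  by rewrite lerDl divr_ge0 ?sqr_ge0 // ltW.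
apply: le_trans (_ : n%:R * 1 <= _).
  apply: ler_wpM2l; first exact: ltW.
  rewrite ler_norml.
  have /andP[p0 p1] := p01 n n1.
  have : n%:R^-1 <= 1 :> R by rewrite invf_le1 // ler1n.
  have : 0 <= n%:R^-1 :> R by rewrite invr_ge0.
  by move=> *; apply/andP; split; lra.
have kt : 0 <= k / t by apply: divr_ge0; lra.
rewrite mulr1; apply: le_trans (_ : N%:R ^+ 2 / t <= _); last by lra.
rewrite ler_pdivlMr //; have nNR : n%:R <= N%:R :> R by rewrite ler_nat ltnW.
have tN : t <= n%:R.
  by rewrite -tn exprS; apply: ler_peMr; [exact: ltW | exact: exprn_ege1].
by rewrite expr2; apply: ler_pM => //; [exact: ltW | exact: le_trans nNR].
Qed.


Theorem theorem4 (R : realType) (p : nat -> R)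
    (p01 : forall n : nat, (1 <= n)%N -> 0 <= p n <= 1)
    (pO : (fun n => p n - n%:R^-1) =O_\oo (fun n => n%:R `^ (- (4 / 3)) : R)) :
  exists c C : R, [/\ 0 < c, 0 < C &
    forall (n : nat) (x : R), (1 <= n)%N -> C < x ->
      Gnp_pr (p n) (fun G : {set 'I_n * 'I_n} =>
          ((x * n%:R `^ (1 / 3))%:E < diam R G)%E)
        <= Gnp_pr (p n) (fun G : {set 'I_n * 'I_n} =>
          x * n%:R `^ (1 / 3) < (longest_saop G)%:R)
      /\ Gnp_pr (p n) (fun G : {set 'I_n * 'I_n} =>
          x * n%:R `^ (1 / 3) < (longest_saop G)%:R)
        <= expR (- (c * x * ln x))].
Proof.
have [La La1 Hnp] := critical_window p01 pO.
have [B BE] : exists B, B = 16 * La by exists (16 * La).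
have B16 : 16 <= B by rewrite BE; lra.
have [u [u0 u1 uE]] : exists u : R, [/\ 0 < u, u <= 1 &
    forall v, v / (200 * B) / 12 = v * u].
  have B0 : 0 < (200 * B)^-1 by rewrite invr_gt0; lra.
  have B1 : (200 * B)^-1 <= 1 by rewrite invf_le1; lra.
  by exists ((200 * B)^-1 / 12); split; [lra | lra | move=> v; rewrite mulrA].
have [c1 [c10 c11 c1E]] : exists c1 : R, [/\ 0 < c1, c1 / 4 <= 1 / 24 &
    forall v, (v / (200 * B) / 12) ^+ 3 / 100 = c1 * v ^+ 3].
  have u30 : 0 < u ^+ 3 by exact: exprn_gt0.
  have u31 : u ^+ 3 <= 1 by apply: exprn_ile1 => //; exact: ltW.
  exists (u ^+ 3 / 100); split; [lra | lra | move=> v].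
  by rewrite uE; field.
have [D [D0 DE]] : exists D : R, 0 <= D /\ 48 * expR (4 * La) <= expR D.
  (* 48 is [1 + 47], hence at most [expR 47]. *)
  exists (47 + 4 * La); split; first by lra.
  rewrite expRD; apply: ler_wpM2r; first exact: expR_ge0.
  by apply: le_trans (expR_ge1Dx _); lra.
have [E [E0 EE]] : exists E : R, 0 <= E /\ 200 * B * (480 * La) ^+ 2 <= E.
  exists (200 * B * (480 * La) ^+ 2); split; last exact: lexx.
  by apply: mulr_ge0; [lra | exact: sqr_ge0].
have F0 := sqr_ge0 (2 * D / c1).
(* The summands of [C] ensure [1 <= x], the threshold of [tail_sparse] and that of
   [absorb_constant]. *)
exists (c1 / 4), (1 + E + (2 * D / c1) ^+ 2); split; [lra | lra |].
move=> n x n1 Cx; set t := n%:R `^ (1 / 3).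
have [t1 tn _] := cube_root R n1; have np := Hnp n n1; rewrite -/t in t1 tn np.
have pn01 := p01 n n1; rewrite !Gnp_prE; split.
  apply: le_bprob => // G _ /lt_le_trans/(_ (diam_le_longest R G)).
  by rewrite lte_fin.
have xE : E <= x by lra.
have xD : (2 * D / c1) ^+ 2 <= x by lra.
have x1 : 1 <= x by lra.
have x0 : 0 < x by lra.
have c40 : 0 < c1 / 4 by lra.
have [xB|Bx] := leP x (B * t ^+ 2); last first.
  rewrite BE in Bx; apply: (tail_dense La1 t1 tn pn01 np) Bx => //.
  by rewrite c11 c40.
apply: le_trans (tail_sparse La1 t1 tn pn01 np BE xB (le_trans EE xE)) _.
rewrite c1E; apply: le_trans (_ : expR (D - c1 * Num.sqrt x ^+ 3) <= _).
  by rewrite expRD; apply: ler_wpM2r => //; exact: expR_ge0.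
by rewrite ler_expR; exact: absorb_constant.
Qed.
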